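(* Let $X$ be a nonempty finite strongly regular CW complex with a free involution that permutes its cells. If $X$ has $v$ vertices and $f$ facets, then $$\operatorname{ind} X\leq C_0\,\log v\,\log f,\qquad C_0=24e^2.$$ In particular, this holds for every (nonempty) finite simplicial complex with a free simplicial involution.
   Context: All logarithms are natural. A finite CW complex is strongly regular if its characteristic maps are embeddings and the intersection of any two closed cells is empty or a closed cell. Its vertices are its $0$-cells; its facets are its inclusion-maximal (closed) cells. For a simplicial complex the facets are the inclusion-maximal simplices, and a simplicial involution is called free if the induced involution on the geometric realization has no fixed point. A free involution on a space $X$ is a continuous map $\tau\colon X\to X$ with $\tau\circ\tau=\mathrm{id}$ and $\tau(x)\neq x$ for all $x$. A continuous map between spaces with free involutions is equivariant if it commutes with the involutions. The index of a space $X$ with a free involution is $$\operatorname{ind} X=\min\{k\geq 0:\text{there is an equivariant map }X\to S^k\},$$ where spheres carry the antipodal involution $x\mapsto -x$; the value is $+\infty$ if no such map exists, and $\operatorname{ind}\varnothing=-1$. *)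

(* Defs.v *)
From HB Require Import structures.
From mathcomp Require Import all_boot all_order all_algebra.
From mathcomp Require Import all_classical all_reals all_analysis.
Set Implicit Arguments.
Unset Strict Implicit.
Unset Printing Implicit Defensive.
Import Order.TTheory GRing.Theory Num.Theory.
Import numFieldNormedType.Exports.
Local Open Scope classical_set_scope.
Local Open Scope ring_scope.

Section Euclidean.
Context {R : realType}.

Definition sqnorm n (x : 'rV[R]_n) : R := \sum_(i < n) x 0 i ^+ 2.

(* The library norm on ['rV[R]_n] is the sup norm, so the Euclidean balls are
   defined from [sqnorm]. For [n = 0] both balls are a point and the sphere is
   empty. *)
Definition unit_ball n : set 'rV[R]_n := [set x | sqnorm x <= 1].
Definition open_unit_ball n : set 'rV[R]_n := [set x | sqnorm x < 1].
Definition unit_sphere n : set 'rV[R]_n := [set x | sqnorm x = 1].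

Lemma sqnormN n (x : 'rV[R]_n) : sqnorm (- x) = sqnorm x.
Proof. by apply: eq_bigr => i _; rewrite mxE sqrrN. Qed.

End Euclidean.

(* [f] restricts to a homeomorphism from [A] onto [f @` A]. *)
Definition embedding_on (S T : topologicalType) (A : set S) (f : S -> T) :=
  [/\ {within A, continuous f}, set_inj A f &
      forall U : set S, open U ->
        exists2 V : set T, open V & f @` (A `&` U) = f @` A `&` V].

(* Finiteness makes closure-finiteness and the weak topology automatic: a
   finite family of compact closed cells in a Hausdorff space determines its
   topology. *)
Record finite_cw (R : realType) (X : topologicalType) := FiniteCW {
  cell : finType;
  dim : cell -> nat;
  charmap : forall c : cell, 'rV[R]_(dim c) -> X;
  cw_hausdorff : hausdorff_space X;
  charmap_continuous :
    forall c, {within @unit_ball R (dim c), continuous (@charmap c)};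
  charmap_interior :
    forall c, embedding_on (@open_unit_ball R (dim c)) (@charmap c);
  cw_partition :
    forall x, exists! c, (@charmap c @` @open_unit_ball R (dim c)) x;
  charmap_boundary :
    forall c, @charmap c @` @unit_sphere R (dim c) `<=`
      \bigcup_(d in [set d | (dim d < dim c)%N])
        (@charmap d @` @open_unit_ball R (dim d)) }.

Arguments charmap {R X f} c x : rename.

Section CW.
Context {R : realType} {X : topologicalType} (K : finite_cw R X).

Definition open_cell (c : cell K) : set X :=
  charmap c @` @open_unit_ball R (dim c).

Definition closed_cell (c : cell K) : set X :=
  charmap c @` @unit_ball R (dim c).

Definition strongly_regular :=
  (forall c : cell K, embedding_on (@unit_ball R (dim c)) (charmap c)) /\
  (forall c d : cell K, closed_cell c `&` closed_cell d = set0 \/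
     exists e : cell K, closed_cell c `&` closed_cell d = closed_cell e).

Definition cw_vertices : {set cell K} := [set c | dim c == 0]%SET.

(* Distinct cells of a CW complex have distinct closures, so inclusion-maximal
   closed cells may be counted by their indices. *)
Definition cw_facets : {set cell K} :=
  [set c | `[< forall d, closed_cell c `<=` closed_cell d ->
                 closed_cell d = closed_cell c >]]%SET.

Definition permutes_cells (tau : X -> X) :=
  forall c, exists d, tau @` open_cell c = open_cell d.

End CW.

Definition free_involution (X : topologicalType) (tau : X -> X) :=
  [/\ continuous tau, involutive tau & forall x, tau x <> x].

Definition equivariant_map (X Y : topologicalType) (tauX : X -> X)
    (tauY : Y -> Y) (f : X -> Y) :=
  continuous f /\ forall x, f (tauX x) = tauY (f x).

Section Index.
Context (R : realType).

(* [set_type] carries the subspace topology. *)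
Definition Sph (k : nat) : topologicalType := set_type (@unit_sphere R k.+1).

Lemma antipode_subproof k (x : Sph k) :
  - set_val x \in @unit_sphere R k.+1.
Proof.
by apply/mem_set; rewrite /unit_sphere /= sqnormN; exact: set_valP x.
Qed.

Definition antipode k (x : Sph k) : Sph k := SigSub (antipode_subproof x).

Definition ind (X : topologicalType) (tau : X -> X) : \bar R :=
  if pselect ([set: X] !=set0) then
    if pselect (exists k : nat,
        `[< exists f : X -> Sph k, equivariant_map tau (@antipode k) f >])
      is left ex_map then ((ex_minn ex_map)%:R)%:E
    else +oo%E
  else (-1)%:E.

End Index.

(* The vertex set is all of [V], and the empty set is not a simplex. *)
Record simplicial_complex (V : finType) := SimplicialComplex {
  simplices :> {set {set V}};
  simplex_neq0 : finset.set0 \notin simplices;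
  simplex_vertex : forall v : V, [set v]%SET \in simplices;
  simplex_face : forall s t : {set V}, s \in simplices -> t \subset s ->
    t != finset.set0 -> t \in simplices }.

Definition simplicial_map (V W : finType) (K : simplicial_complex V)
    (L : simplicial_complex W) (f : V -> W) :=
  forall s : {set V}, s \in simplices K -> (f @: s)%SET \in simplices L.

Definition facets (V : finType) (K : simplicial_complex V) : {set {set V}} :=
  [set s | maxset (fun t => t \in simplices K) s]%SET.

Section Realization.
Context (R : realType).

(* Barycentric coordinates; on R^V the pointwise topology is the Euclidean
   one. *)
Definition realization_set (V : finType) (K : simplicial_complex V) :
    set {ptws V -> R} :=
  [set a | [/\ forall v, 0 <= a v, \sum_(v : V) a v = 1 &
               [set v | a v != 0]%SET \in simplices K]].

Definition realization (V : finType) (K : simplicial_complex V) :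
  topologicalType := set_type (realization_set K).

Definition push (V W : finType) (f : V -> W) (a : {ptws V -> R}) :
    {ptws W -> R} :=
  fun w => \sum_(v : V | f v == w) a v.

Lemma push_subproof (V W : finType) (K : simplicial_complex V)
    (L : simplicial_complex W) (f : V -> W) (fKL : simplicial_map K L f)
    (a : realization K) : push f (set_val a) \in realization_set L.
Proof.
have [a_ge0 a_sum a_supp] : realization_set K (set_val a) by exact: set_valP a.
apply/mem_set; split.
- by move=> w; apply: sumr_ge0.
- by rewrite -a_sum (partition_big f xpredT).
suff -> : [set w | push f (set_val a) w != 0]%SET =
    (f @: [set v | set_val a v != 0])%SET by exact: fKL.
apply/setP => w; rewrite inE; apply/idP/imsetP => [|[v]].
  rewrite psumr_neq0 => [/hasP[v _ /andP[/eqP fv av]]|v _]; last exact: a_ge0.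
  by exists v; rewrite ?inE ?gt_eqF.
rewrite inE => av ->; rewrite psumr_neq0 => [|u _]; last exact: a_ge0.
apply/hasP; exists v; first exact: mem_index_enum.
by rewrite eqxx lt0r av a_ge0.
Qed.

Definition realization_map (V W : finType) (K : simplicial_complex V)
    (L : simplicial_complex W) (f : V -> W) (fKL : simplicial_map K L f)
    (a : realization K) : realization L := SigSub (push_subproof fKL a).

End Realization.

(* Main.v *)
Require Import Defs.
From HB Require Import structures.
From mathcomp Require Import all_boot all_order all_algebra.
From mathcomp Require Import all_classical all_reals all_analysis.
From mathcomp Require Import ring lra.
Import Order.TTheory GRing.Theory Num.Theory.
Import numFieldNormedType.Exports.
Local Open Scope classical_set_scope.
Local Open Scope ring_scope.

(** The index is bounded by pushing the space through a continuous odd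
    dynamical system that squeezes it into few small balls away from the
    origin, and then applying a random linear map that misses zero.

    Let [V] be the vertices and [F] the facets, both with the induced
    involution, and let [S u p] be 1 when [p] contains [u], -1 when it contains
    the image of [u], and 0 otherwise ([sign_inc]). No facet contains both, so
    [S u p] is 1 for every vertex [u] of [p], and [S] is odd in each argument.
    Suppose that every point of the space carries a probability vector [x] on
    [V], supported by the vertices of one facet and depending on the point
    continuously and equivariantly. Its scores are
    [a p = be * \sum_u x u * S u p] ([start]), and one step of the system
    ([mirror]) replaces [a] by the scores of softmax (be' * S (softmax a)).

    The scores never die. A step is an alternate maximisation of the entropic
    functional <nu, S x> + H(nu) / be + H(x) / be', so by the inequality of
    Gibbs the [energy] does not decrease ([energy_mirror]). It is at least 1 at
    the start because the support of [x] lies in a facet ([energy_start]). With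
    be slightly above 2 ln #|F| and be' slightly above 2 ln #|V| the entropies
    contribute less than 1, so some score of every iterate is bounded below in
    absolute value ([energy_large]).

    The orbit is thin. Displacements at [a] are measured by the l2 norm with
    weights [softmax a]. Half a step maps a ball of squared radius r into
    9 e^lam balls of squared radius about 6 be^2 r / lam ([halfstep_cover]):
    the increment of a softmax average is an exact linear expression in centred
    entries of [S] ([halfstepB]), and a separated family of such expressions is
    small by a second moment argument on the sign cube ([packing]). Hence a
    step costs a factor (9 e^lam)^2 in the number of balls and divides the
    radius by e once lam is about 6 e be be'.

    Zero is avoided. After k steps every iterate is within a distance of order
    e^-k of one of at most N0 (9 e^lam)^(2k) centres, each with a coordinate
    bounded below. A random linear functional is that small at such a centre
    with probability of order e^-k, so M independent ones are simultaneously
    small at some centre with probability less than 1 as soon as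
    M > 2 lam + ln 81 and k is large ([orbit_avoid]). The resulting odd map to
    R^M without the origin shows that the index is at most M - 1, and
    2 lam + ln 81 is at most 24 e^2 ln #|V| ln #|F| ([odd_map_exists],
    [ind_le_log]).

    For a simplicial complex the probability vectors are the barycentric
    coordinates. For a strongly regular CW complex they come from a symmetrised
    partition of unity subordinate to the open stars of the vertices
    ([urysohn_cover], [vertex_star_open]). There, no closed cell c contains a
    vertex and its image: otherwise the intersection of c with its image would
    be a nonempty closed cell, that is a ball, mapped to itself without fixed
    point, against the fixed point theorem of Brouwer. The latter is proved
    from a cubical Sperner lemma of Kuhn in the form of a mod 2 Stokes formula
    ([kuhn_stokes], [kuhn_labelling], [brouwer_ball]). *)

Set Implicit Arguments.
Unset Strict Implicit.
Unset Printing Implicit Defensive.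

(** * Packing of linear images of sign vectors *)
Section Packing.
Context {R : realType}.
Implicit Types I J : finType.

(** The local metric: [x] will be the softmax of the scores at the base point. *)
Definition wsq J (x u : J -> R) : R := \sum_j x j * u j ^+ 2.

Definition sgnb (b : bool) : R := (-1) ^+ b.

(** The product law of independent signs [sgnb (w i)] with means [c i]. *)
Definition biased I (c : I -> R) (w : {ffun I -> bool}) : R :=
  \prod_i ((1 + c i * sgnb (w i)) / 2).

Lemma biased_prod I (c : I -> R) (g : I -> bool -> R) :
  \sum_(w : {ffun I -> bool}) biased c w * \prod_i g i (w i) =
  \prod_i \sum_(b : bool) (1 + c i * sgnb b) / 2 * g i b.
Proof.
rewrite bigA_distr_bigA; apply: eq_bigr => w _.
by rewrite /biased -big_split.
Qed.

Lemma sum_bool (F : bool -> R) : \sum_(b : bool) F b = F true + F false.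
Proof. by rewrite big_bool. Qed.

Lemma biased_sum I (c : I -> R) : \sum_(w : {ffun I -> bool}) biased c w = 1.
Proof.
transitivity (\sum_(w : {ffun I -> bool}) biased c w * \prod_(i in I) (1 : R)).
  by apply: eq_bigr => w _; rewrite big1 ?mulr1.
rewrite (biased_prod c (fun _ _ => 1)) big1// => i _.
by rewrite sum_bool /sgnb /=; field.
Qed.

(** Distinct coordinates are uncorrelated, since the factors other than [i] and
    [k] integrate to 1. *)
Lemma biased_cov I (c : I -> R) (i k : I) :
  \sum_(w : {ffun I -> bool})
     biased c w * ((sgnb (w i) - c i) * (sgnb (w k) - c k)) =
  if i == k then 1 - c i ^+ 2 else 0.
Proof.
pose g (l : I) (b : bool) : R :=
  (if l == i then sgnb b - c l else 1) * (if l == k then sgnb b - c l else 1).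
transitivity (\sum_(w : {ffun I -> bool}) biased c w * \prod_l g l (w l)).
  apply: eq_bigr => w _; congr (_ * _).
  rewrite /g big_split /=; congr (_ * _).
    by rewrite -big_mkcond big_pred1_eq.
  by rewrite -big_mkcond big_pred1_eq.
rewrite biased_prod (bigD1 i) //= /g eqxx.
case: (eqVneq i k) => [<-|ik].
  rewrite [X in _ * X]big1 => [|l li]; last first.
    by rewrite (negPf li) sum_bool /sgnb /=; field.
  by rewrite sum_bool /sgnb /=; field.
by rewrite sum_bool /sgnb /=; field.
Qed.

Lemma biased_ge0 I (c : I -> R) w : (forall i, `|c i| <= 1) -> 0 <= biased c w.
Proof.
move=> c1; apply: prodr_ge0 => i _; rewrite divr_ge0// /sgnb.
by have := c1 i; rewrite ler_norml => /andP[]; case: (w i) => /=; lra.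
Qed.

(** Writing one of the two factors as a product over coordinates turns the
    second moment of the density into an expectation that factorises. *)
Lemma biased_sqsum I (c : I -> R) :
  \sum_(w : {ffun I -> bool}) biased c w ^+ 2 * 2 ^+ #|I| =
  \prod_i (1 + c i ^+ 2).
Proof.
transitivity (\sum_(w : {ffun I -> bool}) biased c w *
   \prod_i (1 + c i * sgnb (w i))).
  apply: eq_bigr => w _; rewrite expr2 -mulrA; congr (_ * _).
  rewrite /biased -prodr_const -big_split /=; apply: eq_bigr => i _.
  by field.
rewrite (biased_prod c (fun i b => 1 + c i * sgnb b)); apply: eq_bigr => i _.
by rewrite sum_bool /sgnb /=; field.
Qed.

Definition comb I J (w : I -> J -> R) (h : I -> R) : J -> R :=
  fun j => \sum_i h i * w i j.

(** Expanding the square leaves only the diagonal, by [biased_cov]. *)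
Lemma biased_variance I J (x : J -> R) (v : I -> J -> R) (c : I -> R) :
  (forall j, 0 <= x j) ->
  \sum_(w : {ffun I -> bool}) biased c w *
     wsq x (fun j => comb v (fun i => sgnb (w i)) j - comb v c j)
  <= \sum_j x j * \sum_i v i j ^+ 2.
Proof.
move=> x0.
have -> : \sum_(w : {ffun I -> bool}) biased c w *
     wsq x (fun j => comb v (fun i => sgnb (w i)) j - comb v c j) =
  \sum_j x j * \sum_i \sum_k v i j * v k j *
    \sum_(w : {ffun I -> bool}) biased c w *
      ((sgnb (w i) - c i) * (sgnb (w k) - c k)).
  under eq_bigr do rewrite /wsq mulr_sumr.
  rewrite exchange_big; apply: eq_bigr => j _ /=.
  rewrite mulr_sumr.
  under [RHS]eq_bigr => i _ do rewrite mulr_sumr.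
  under [RHS]eq_bigr => i _ do under eq_bigr => k _ do rewrite mulrA mulr_sumr.
  under [RHS]eq_bigr => i _ do rewrite exchange_big.
  rewrite exchange_big; apply: eq_bigr => w _ /=.
  rewrite /comb -sumrB expr2 mulr_suml !mulr_sumr; apply: eq_bigr => i _.
  rewrite !mulr_sumr; apply: eq_bigr => k _.
  ring.
apply: ler_sum => j _; apply: ler_wpM2l => //.
apply: ler_sum => i _; rewrite (bigD1 i) //= [X in _ + X]big1 => [|k ki]; last first.
  by rewrite biased_cov eq_sym (negPf ki) mulr0.
rewrite biased_cov eqxx addr0 -expr2 ler_piMr ?sqr_ge0//.
by rewrite gerBl sqr_ge0.
Qed.

Lemma sqr_sum_card (T : finType) (A : {set T}) (F : T -> R) :
  (\sum_(t in A) F t) ^+ 2 <= #|A|%:R * \sum_(t in A) F t ^+ 2.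
Proof.
have [->|A0] := eqVneq A finset.set0.
  by rewrite !big_set0 cards0 mul0r expr0n.
have n0 : 0 < #|A|%:R :> R by rewrite ltr0n card_gt0.
set s := \sum_(t in A) F t; set q := \sum_(t in A) _.
have : 0 <= \sum_(t in A) (F t - s / #|A|%:R) ^+ 2.
  by apply: sumr_ge0 => t _; exact: sqr_ge0.
have -> : \sum_(t in A) (F t - s / #|A|%:R) ^+ 2 = q - s ^+ 2 / #|A|%:R.
  under eq_bigr do rewrite sqrrB.
  rewrite big_split /= sumrB sumr_const -/q.
  under [X in _ - X + _]eq_bigr do rewrite -mulr_natr mulrAC -mulrA.
  rewrite -mulr_suml -/s -[_ *+ #|_|]mulr_natr; field.
  by rewrite gt_eqF.
by rewrite subr_ge0 ler_pdivrMr// mulrC.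
Qed.

Lemma wsqB_le J (x u v : J -> R) : (forall j, 0 <= x j) ->
  wsq x (fun j => u j - v j) <= 2 * wsq x u + 2 * wsq x v.
Proof.
move=> x0; rewrite /wsq !mulr_sumr -big_split; apply: ler_sum => j _ /=.
have := sqr_ge0 (u j + v j); have := x0 j; nra.
Qed.

Lemma wsq_ge0 J (x u : J -> R) : (forall j, 0 <= x j) -> 0 <= wsq x u.
Proof. by move=> x0; apply: sumr_ge0 => j _; rewrite mulr_ge0 ?sqr_ge0. Qed.

(** A volume argument on the sign cube. Random signs with means [h l] give a
    combination of squared distance at most 3/2 from that of [h l] with
    probability at least 1/3, by the inequality of Markov. As the density has
    second moment at most e^lam times that of the uniform law, Cauchy-Schwarz
    shows that this event fills at least a fraction e^-lam / 9 of the cube.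
    Since 6 = 2 * (3/2 + 3/2), the events of distinct [l] are disjoint. *)
Lemma packing_small I J (x : J -> R) (v : I -> J -> R) (lam : R)
    n (h : 'I_n -> I -> R) :
  (forall j, 0 <= x j) -> \sum_j x j * \sum_i v i j ^+ 2 <= 1 ->
  (forall l i, `|h l i| <= 1) -> (forall l, \sum_i h l i ^+ 2 <= lam) ->
  (forall l k, l != k ->
     6 < wsq x (fun j => comb v (h l) j - comb v (h k) j)) ->
  n%:R <= 9 * expR lam.
Proof.
move=> x0 v1 h1 hlam sep.
pose dev l (w : {ffun I -> bool}) :=
  wsq x (fun j => comb v (fun i => sgnb (w i)) j - comb v (h l) j).
pose A l := [set w : {ffun I -> bool} | dev l w <= 3 / 2]%SET.
have Acard l : (2 ^+ #|I| : R) <= 9 * expR lam * #|A l|%:R.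
  have Pge : 1 / 3 <= \sum_(w in A l) biased (h l) w.
    have tot := biased_sum (h l).
    rewrite (bigID (mem (A l))) /= in tot.
    have mk : \sum_(w | w \notin A l) biased (h l) w <= 2 / 3.
      have H := le_trans (biased_variance v (h l) x0) v1.
      have : \sum_(w | w \notin A l) biased (h l) w * (3 / 2) <= 1.
        apply: le_trans H; rewrite [leRHS](bigID (mem (A l))) /=.
        rewrite -[leLHS]add0r; apply: lerD.
          apply: sumr_ge0 => w _.
          by rewrite mulr_ge0 ?biased_ge0 ?wsq_ge0.
        apply: ler_sum => w; rewrite inE -ltNge => /ltW dw.
        by apply: ler_wpM2l => //; exact: biased_ge0.
      by rewrite -mulr_suml; lra.
    by lra.
  have cs := sqr_sum_card (A l) (biased (h l)).
  have tail : (\sum_(t in A l) biased (h l) t ^+ 2) * 2 ^+ #|I| <= expR lam.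
    apply: (@le_trans _ _ (\prod_i (1 + h l i ^+ 2))).
      rewrite -biased_sqsum mulr_suml [leRHS](bigID (mem (A l))) /= lerDl.
      by apply: sumr_ge0 => w _; rewrite mulr_ge0 ?sqr_ge0 ?exprn_ge0.
    apply: le_trans (_ : expR (\sum_i h l i ^+ 2) <= _).
      rewrite expR_sum; apply: ler_prod => i _.
      by rewrite addr_ge0 ?sqr_ge0// expR_ge1Dx.
    by rewrite ler_expR.
  set q := \sum_(t in A l) _ ^+ 2 in cs tail.
  have p0 : 0 < (2 ^+ #|I| : R) by rewrite exprn_gt0.
  have : 1 / 9 <= #|A l|%:R * q.
    apply: le_trans cs.
    have := Pge; set s := \sum_(w in A l) _; nra.
  have a0 : 0 <= #|A l|%:R :> R by rewrite ler0n.
  move: tail p0 a0; set P := 2 ^+ _; set a := #|A l|%:R; set E := expR _.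
  move=> tail p0 a0 /(ler_wpM2r (ltW p0)) H.
  have := ler_wpM2l a0 tail.
  lra.
have disj l k w : w \in A l -> w \in A k -> l = k.
  rewrite !inE => dl dk; apply/eqP/negPn/negP => lk.
  have := sep _ _ lk.
  have := wsqB_le (fun j => comb v (fun i => sgnb (w i)) j - comb v (h k) j)
    (fun j => comb v (fun i => sgnb (w i)) j - comb v (h l) j) x0.
  rewrite -/(dev k w) -/(dev l w).
  have -> : (fun j => comb v (fun i => sgnb (w i)) j - comb v (h k) j -
     (comb v (fun i => sgnb (w i)) j - comb v (h l) j)) =
     (fun j => comb v (h l) j - comb v (h k) j).
    by apply/funext => j; ring.
  lra.
have : (\sum_(l < n) #|A l| <= 2 ^ #|I|)%N.
  have -> : (2 ^ #|I| = #|{ffun I -> bool}|)%N by rewrite card_ffun card_bool.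
  rewrite -sum1_card; apply: leq_trans (_ : \sum_(l < n) \sum_(w in A l) 1 <= _)%N.
    by apply: leq_sum => l _; rewrite sum1_card.
  rewrite (exchange_big_dep xpredT) //=; apply: leq_sum => w _.
  rewrite sum1_card; apply/card_le1_eqP => l k wl wk.
  exact: (disj _ _ w wk wl).
rewrite -(ler_nat R) natr_sum natrX => Hsum.
have p0 : 0 < (2 ^+ #|I| : R) by rewrite exprn_gt0.
rewrite -(ler_pM2r p0).
apply: le_trans (_ : \sum_(l < n) 9 * expR lam * #|A l|%:R <= _).
  have -> : n%:R * 2 ^+ #|I| = \sum_(l < n) (2 ^+ #|I| : R).
    by rewrite sumr_const card_ord mulr_natl.
  by apply: ler_sum.
by rewrite -mulr_sumr; apply: ler_wpM2l => //; rewrite mulr_ge0// expR_ge0.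
Qed.

(** The bound on the coefficients is removed by splitting each index into [q]
    copies, with [q] at least lam, and dividing [h] and [v] by sqrt q, which
    changes none of the other quantities. *)
Lemma packing I J (x : J -> R) (v : I -> J -> R) (lam : R)
    n (h : 'I_n -> I -> R) :
  (forall j, 0 <= x j) -> \sum_j x j * \sum_i v i j ^+ 2 <= 1 ->
  (forall l, \sum_i h l i ^+ 2 <= lam) ->
  (forall l k, l != k ->
     6 < wsq x (fun j => comb v (h l) j - comb v (h k) j)) ->
  n%:R <= 9 * expR lam.
Proof.
move=> x0 v1 hlam sep.
pose q := (Num.bound `|lam|).+1.
have q0 : 0 < q%:R :> R by rewrite ltr0n.
have lamq : lam <= q%:R.
  apply: le_trans (ler_norm _) _; apply: ltW.
  by apply: lt_le_trans (archi_boundP (normr_ge0 _)) _; rewrite ler_nat.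
pose sq := Num.sqrt (q%:R : R).
have sq0 : 0 < sq by rewrite sqrtr_gt0.
have sq2 : sq ^+ 2 = q%:R by rewrite sqr_sqrtr// ltW.
pose v' (p : I * 'I_q) j := v p.1 j / sq.
pose h' l (p : I * 'I_q) := h l p.1 / sq.
have sumq (F : I -> R) : \sum_(p : I * 'I_q) F p.1 / q%:R = \sum_i F i.
  rewrite -(pair_bigA _ (fun i (s : 'I_q) => F i / q%:R)) /=.
  apply: eq_bigr => i _; rewrite sumr_const card_ord -[_ *+ q]mulr_natr.
  by rewrite divfK// gt_eqF.
have comb' l j : comb v' (h' l) j = comb v (h l) j.
  rewrite /comb -sumq; apply: eq_bigr => p _; rewrite /v' /h' -sq2.
  by field; rewrite gt_eqF.
apply: (@packing_small _ _ x v' lam n h') => //.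
- apply: le_trans v1; apply: ler_sum => j _; apply: ler_wpM2l => //.
  rewrite -(sumq (fun i => v i j ^+ 2)); apply: ler_sum => p _.
  by rewrite /v' -sq2 exprMn exprVn.
- move=> l [i s]; rewrite /h' /= normrM normfV (gtr0_norm sq0) ler_pdivrMr//.
  rewrite mul1r -[sq]gtr0_norm// -ler_sqr ?nnegrE// !real_normK ?num_real// sq2.
  apply: le_trans lamq; apply: le_trans (hlam l).
  by rewrite (bigD1 i) //= lerDl; apply: sumr_ge0 => k _; exact: sqr_ge0.
- move=> l; apply: le_trans (hlam l).
  rewrite -(sumq (fun i => h l i ^+ 2)); apply: ler_sum => p _.
  by rewrite /h' -sq2 exprMn exprVn.
- move=> l k lk; under eq_fun do rewrite !comb'; exact: sep.
Qed.

End Packing.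

(** * Softmax averages and their increments *)
Section Softmax.
Context {R : realType}.
Implicit Types I J : finType.

(** A separated family of maximal size is a net. *)
Lemma maximal_separated (T : choiceType) (Q : T -> Prop) (sep : T -> T -> Prop)
    (N : R) :
  (forall s : seq T, (forall a, a \in s -> Q a) ->
     pairwise (fun a b => `[< sep a b >]) s -> (size s)%:R <= N) ->
  exists s : seq T, [/\ (size s)%:R <= N, forall a, a \in s -> Q a &
    forall a, Q a -> exists2 b, b \in s & ~ sep a b].
Proof.
move=> Nbound.
pose P n := `[< exists s : seq T, [/\ size s = n, forall a, a \in s -> Q a &
   pairwise (fun a b => `[< sep a b >]) s] >].
have P0 : exists n, P n by exists 0%N; apply/asboolP; exists [::].
have Pb n : P n -> (n <= Num.bound N)%N.
  move=> /asboolP[s [<- sQ sp]]; rewrite -(ler_nat R); apply: ltW.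
  apply: le_lt_trans (Nbound s sQ sp) _; apply: archi_boundP.
  by apply: le_trans (Nbound s sQ sp).
case: (ex_maxnP P0 Pb) => n /asboolP[s [sn sQ sp]] nmax.
exists s; split=> //; first exact: Nbound.
move=> a Qa; apply: contrapT => nsep.
suff /nmax : P n.+1 by rewrite ltnn.
apply/asboolP; exists (a :: s); split => /=; first by rewrite sn.
  by move=> b; rewrite inE => /predU1P[->//|/sQ].
rewrite sp andbT; apply/allP => b bs; apply/asboolP.
by apply: contrapT => nab; apply: nsep; exists b.
Qed.

Definition partition_sum I (a : I -> R) : R := \sum_i expR (a i).

Definition softmax I (a : I -> R) (i : I) : R := expR (a i) / partition_sum a.

Definition halfstep I J (bt : R) (S : I -> J -> R) (a : I -> R) (j : J) : R :=
  bt * \sum_i softmax a i * S i j.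

Definition box I (al : R) (a : I -> R) := forall i, `|a i| <= al.

Lemma partition_sum_gt0 I (i0 : I) (a : I -> R) : 0 < partition_sum a.
Proof.
rewrite /partition_sum (bigD1 i0) //=; apply: ltr_pwDl; first exact: expR_gt0.
by apply: sumr_ge0 => i _; exact: expR_ge0.
Qed.

Lemma softmax_gt0 I (a : I -> R) i : 0 < softmax a i.
Proof. by rewrite divr_gt0 ?expR_gt0// (partition_sum_gt0 i). Qed.

Lemma softmax_ge0 I (a : I -> R) i : 0 <= softmax a i.
Proof. exact/ltW/softmax_gt0. Qed.

Lemma softmax_sum I (i0 : I) (a : I -> R) : \sum_i softmax a i = 1.
Proof. by rewrite -mulr_suml divff// gt_eqF// (partition_sum_gt0 i0). Qed.

Lemma mean_bound I (p : I -> R) (u : I -> R) (M : R) :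
  (forall i, 0 <= p i) -> \sum_i p i = 1 -> (forall i, `|u i| <= M) ->
  `|\sum_i p i * u i| <= M.
Proof.
move=> p0 p1 uM; apply: le_trans (ler_norm_sum _ _ _) _.
rewrite -[leRHS]mul1r -p1 mulr_suml; apply: ler_sum => i _.
by rewrite normrM ger0_norm// ler_wpM2l.
Qed.

Lemma halfstep_box I J (i0 : I) (bt : R) (S : I -> J -> R) (a : I -> R) :
  0 <= bt -> (forall i j, `|S i j| <= 1) -> box bt (halfstep bt S a).
Proof.
move=> bt0 S1 j; rewrite /halfstep normrM ger0_norm// ler_piMr//.
by apply: mean_bound => //; [exact: softmax_ge0|exact: softmax_sum].
Qed.

Lemma softmax_lb I (al : R) (a : I -> R) i :
  box al a -> expR (- (al + al)) / #|I|%:R <= softmax a i.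
Proof.
move=> ba; rewrite /softmax.
have n0 : 0 < #|I|%:R :> R by rewrite ltr0n; apply/card_gt0P; exists i.
rewrite opprD expRD -mulrA; apply: ler_pM.
- exact: expR_ge0.
- by rewrite divr_ge0 ?expR_ge0 ?ltW.
- by rewrite ler_expR; have := ba i; rewrite ler_norml => /andP[].
rewrite expRN -invfM lef_pV2 ?posrE ?mulr_gt0 ?expR_gt0 ?(partition_sum_gt0 i)//.
rewrite /partition_sum mulr_natr -sumr_const; apply: ler_sum => k _.
by rewrite ler_expR; have := ba k; rewrite ler_norml => /andP[].
Qed.

(** This compares the local metrics at nearby base points. *)
Lemma softmax_ratio I (a c : I -> R) (s : R) i :
  (forall k, `|a k - c k| <= s) -> softmax a i <= softmax c i * expR (s + s).
Proof.
move=> ac; rewrite /softmax expRD [leRHS]mulrACA; apply: ler_pM; first exact: expR_ge0.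
- by rewrite invr_ge0 ltW ?(partition_sum_gt0 i).
- by rewrite -expRD ler_expR -lerBlDl; have := ac i; rewrite ler_norml => /andP[].
rewrite -[expR s]invrK -expRN -invfM lef_pV2 ?posrE ?mulr_gt0
  ?expR_gt0 ?(partition_sum_gt0 i)//.
rewrite mulr_suml; apply: ler_sum => k _; rewrite -expRD ler_expR.
by have := ac k; rewrite ler_norml => /andP[+ _]; rewrite lerBrDl.
Qed.

(** Up to an additive constant, the relative density of [softmax a] with respect
    to [softmax c]. *)
Definition tilt I (a c : I -> R) (i : I) : R :=
  (expR (a i - c i) - 1) / \sum_k softmax c k * expR (a k - c k).

Definition centered I J (S : I -> J -> R) (c : I -> R) i j : R :=
  S i j - \sum_k softmax c k * S k j.

(** An exact first order expansion. Replacing the relative density of the two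
    softmax laws by [tilt] changes it by a constant, and constants vanish
    against the centred entries. *)
Lemma halfstepB I J (bt : R) (S : I -> J -> R) (a c : I -> R) j :
  halfstep bt S a j - halfstep bt S c j =
  bt * \sum_i softmax c i * tilt a c i * centered S c i j.
Proof.
case: (pickP (@predT I)) => [i0 _|I0]; last first.
  by rewrite /halfstep !big_pred0 // !mulr0 subrr.
rewrite /halfstep -mulrBr; congr (_ * _); rewrite /tilt.
set D := \sum_k _ * expR _.
have Zc := partition_sum_gt0 i0 c; have Za := partition_sum_gt0 i0 a.
have DE : D = partition_sum a / partition_sum c.
  rewrite /D [in RHS]/partition_sum mulr_suml; apply: eq_bigr => k _.
  by rewrite /softmax mulrAC -expRD addrC subrK.
have D0 : 0 < D by rewrite DE divr_gt0.
have smE i : softmax a i = softmax c i * expR (a i - c i) / D.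
  rewrite /softmax DE expRB; field.
  by rewrite !gt_eqF ?expR_gt0.
rewrite /centered; set m := \sum_k softmax c k * S k j.
have eqm : \sum_i softmax c i * ((expR (a i - c i) - 1) / D) = 1 - D^-1.
  under eq_bigr => i _ do rewrite mulrBl mul1r mulrBr mulrA -smE.
  by rewrite sumrB (softmax_sum i0) -mulr_suml (softmax_sum i0) mul1r.
under [RHS]eq_bigr => i _ do rewrite mulrBr.
rewrite sumrB -mulr_suml eqm.
under [in RHS]eq_bigr => i _ do rewrite mulrBl mul1r mulrBr mulrA -smE mulrBl.
rewrite sumrB mulrBl mul1r.
have -> : \sum_i softmax c i / D * S i j = m / D.
  by rewrite /m mulr_suml; apply: eq_bigr => i _; rewrite mulrAC.
by ring.
Qed.

Lemma expRB1_sqr (d s : R) : `|d| <= s -> (expR d - 1) ^+ 2 <= d ^+ 2 * expR (s + s).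
Proof.
move=> ds; rewrite expRD -expr2 -exprMn -[leLHS]real_normK ?num_real//.
rewrite -[leRHS]real_normK ?num_real// ler_sqr ?nnegrE//.
rewrite [leRHS]normrM (ger0_norm (expR_ge0 s)).
apply: le_trans (_ : `|d| * expR `|d| <= _); last first.
  by rewrite ler_wpM2l// ler_expR.
have [d0|d0] := leP 0 d.
  have e1 : 1 <= expR d by rewrite -expR0 ler_expR.
  rewrite (ger0_norm d0) ger0_norm ?subr_ge0//.
  have := expR_ge1Dx (- d); have H0 := expR_gt0 d.
  rewrite expRN -(ler_pM2r H0) mulVf ?gt_eqF//; lra.
have e1 : expR d <= 1 by rewrite -expR0 ler_expR ltW.
rewrite (ltr0_norm d0) ler0_norm ?subr_le0// opprB.
have H := expR_ge1Dx d.
have H2 : 1 <= expR (- d) by rewrite -expR0 ler_expR oppr_ge0 ltW.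
nra.
Qed.

Lemma tilt_sqr I (a c : I -> R) (s : R) i : (forall k, `|a k - c k| <= s) ->
  tilt a c i ^+ 2 <= (a i - c i) ^+ 2 * expR (s + s + (s + s)).
Proof.
move=> ac; rewrite /tilt expr_div_n; set D := \sum_k _.
have D1 : expR (- s) <= D.
  rewrite -[leLHS]mul1r -(softmax_sum i c) mulr_suml; apply: ler_sum => k _.
  rewrite ler_wpM2l ?softmax_ge0// ler_expR.
  by have := ac k; rewrite ler_norml => /andP[].
have D0 : 0 < D by apply: lt_le_trans D1; exact: expR_gt0.
rewrite ler_pdivrMr ?exprn_gt0//.
apply: le_trans (expRB1_sqr (ac i)) _.
rewrite [expR (s + s + _)]expRD; set X := _ ^+ 2; set E := expR (s + s).
have -> : X * (E * E) * D ^+ 2 = X * E * (E * D ^+ 2) by ring.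
apply: ler_peMr; first by rewrite mulr_ge0 ?sqr_ge0 ?expR_ge0.
rewrite /E expRD -expr2 -exprMn; apply: exprn_ege1.
by rewrite -ler_pdivrMl ?expR_gt0// mulr1 -expRN.
Qed.

End Softmax.

(** * Covering the image of a small ball *)
Section HalfCover.
Context {R : realType}.
Implicit Types I J : finType.

Lemma sum_sqr_centered I J (i0 : I) (S : I -> J -> R) (c : I -> R) j :
  (forall i j, `|S i j| <= 1) ->
  \sum_i softmax c i * centered S c i j ^+ 2 <= 1.
Proof.
move=> S1; rewrite /centered; set m := \sum_k softmax c k * S k j.
have -> : \sum_i softmax c i * (S i j - m) ^+ 2 =
    \sum_i softmax c i * S i j ^+ 2 - m ^+ 2.
  transitivity (\sum_i (softmax c i * S i j ^+ 2 -
      (m *+ 2) * (softmax c i * S i j) + softmax c i * m ^+ 2)).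
    by apply: eq_bigr => i _; ring.
  rewrite big_split sumrB -mulr_sumr -mulr_suml (softmax_sum i0) -/m /=; ring.
rewrite lerBlDr; apply: le_trans (_ : 1 <= _); last by rewrite lerDl sqr_ge0.
rewrite -(softmax_sum i0 c); apply: ler_sum => i _.
rewrite ler_piMr ?softmax_ge0// -[leLHS]real_normK ?num_real//.
by rewrite expr_le1.
Qed.

(** Put [v i j] = sqrt (softmax c i) * centered and let [h a] be the suitably
    normalised vector of sqrt (softmax c i) * tilt a c i, so that
    [comb v (h a)] is kap / bt times the increment from [c] to [a]. The scale
    kap is chosen so that [h a] has squared norm at most lam on the ball, and
    [packing] then bounds the size of a separated family. The radius [r0] is so
    small that the nonlinearity of [tilt] and the change of metric from the
    image of [c] to the new centre cost no more than the factor 1 + eta. *)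
Lemma halfstep_cover I J (i0 : I) (S : I -> J -> R) (al bt lam eta : R) :
  (forall i j, `|S i j| <= 1) -> 0 < bt -> 0 < lam -> 0 < eta ->
  exists2 r0 : R, 0 < r0 &
  forall (Q : (I -> R) -> Prop) (c : I -> R) (r : R),
  0 < r <= r0 -> box al c ->
  (forall a, Q a -> wsq (softmax c) (fun i => a i - c i) <= r) ->
  exists s : seq (I -> R), [/\ (size s)%:R <= 9 * expR lam,
    forall a, a \in s -> Q a &
    forall a, Q a -> exists2 b, b \in s &
      wsq (softmax (halfstep bt S b))
        (fun j => halfstep bt S a j - halfstep bt S b j)
      <= (1 + eta) * (6 * bt ^+ 2) / lam * r].
Proof.
move=> S1 bt0 lam0 eta0.
have n0 : 0 < #|I|%:R :> R by rewrite ltr0n; apply/card_gt0P; exists i0.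
(* A lower bound for the softmax weights, turning the local metric into a
   bound on each coordinate. *)
pose m : R := expR (- (al + al)) / #|I|%:R.
have m0 : 0 < m by rewrite divr_gt0 ?expR_gt0.
pose del := ln (1 + eta).
have del0 : 0 < del by rewrite ln_gt0// ltrDl.
pose K := 4 + 4 * (bt * expR (1 + 1)).
have K0 : 0 < K by rewrite addr_gt0// !mulr_gt0// expR_gt0.
(* The coordinates move by at most [s0]; all distortions together are at most
   e^(s0 * K). *)
pose s0 := Num.min 1 (del / K).
have s00 : 0 < s0 by rewrite lt_min ltr01 divr_gt0.
have s01 : s0 <= 1 by rewrite ge_min lexx.
have s0K : s0 * K <= del by rewrite -ler_pdivlMr// ge_min lexx orbT.
exists (m * s0 ^+ 2); first by rewrite mulr_gt0 ?exprn_gt0.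
move=> Q c r /andP[r0 rle] bc Qr.
have close a i : Q a -> `|a i - c i| <= s0.
  move=> Qa; rewrite -[s0]gtr0_norm// -ler_sqr ?nnegrE// !real_normK ?num_real//.
  rewrite -(ler_pM2l m0); apply: le_trans rle; apply: le_trans (Qr _ Qa).
  apply: le_trans (_ : softmax c i * (a i - c i) ^+ 2 <= _).
    by rewrite ler_wpM2r ?sqr_ge0//; exact: softmax_lb.
  rewrite /wsq (bigD1 i) //= lerDl; apply: sumr_ge0 => k _.
  by rewrite mulr_ge0 ?sqr_ge0 ?softmax_ge0.
pose x := softmax (halfstep bt S c).
have x0 j : 0 <= x j by exact: softmax_ge0.
have xsum : \sum_j x j <= 1.
  case: (pickP (@predT J)) => [j0 _|J0]; first by rewrite (softmax_sum j0).
  by rewrite big_pred0.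
pose e4 := expR (s0 + s0 + (s0 + s0)).
have e40 : 0 < e4 := expR_gt0 _.
pose kap := Num.sqrt (lam / (r * e4)).
have kap0 : 0 < kap by rewrite sqrtr_gt0 divr_gt0 ?mulr_gt0.
have kap2 : kap ^+ 2 = lam / (r * e4).
  by rewrite sqr_sqrtr// divr_ge0 ?mulr_ge0// ltW.
pose v i j := Num.sqrt (softmax c i) * centered S c i j.
pose h (a : I -> R) i := kap * (Num.sqrt (softmax c i) * tilt a c i).
have sqv i : Num.sqrt (softmax c i) ^+ 2 = softmax c i.
  by rewrite sqr_sqrtr ?softmax_ge0.
have combE a j : comb v (h a) j =
    kap / bt * (halfstep bt S a j - halfstep bt S c j).
  rewrite halfstepB mulrA divfK ?gt_eqF// mulr_sumr; apply: eq_bigr => i _.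
  by rewrite -[in RHS]sqv /h /v; ring.
have hlam a : Q a -> \sum_i h a i ^+ 2 <= lam.
  move=> Qa; have -> : lam = kap ^+ 2 * (r * e4).
    by rewrite kap2 divfK// gt_eqF// mulr_gt0.
  under eq_bigr do rewrite exprMn exprMn sqv.
  rewrite -mulr_sumr ler_wpM2l ?sqr_ge0//.
  apply: le_trans (_ : wsq (softmax c) (fun i => a i - c i) * e4 <= _); last first.
    by apply: ler_wpM2r; [exact: ltW|exact: Qr].
  rewrite /wsq mulr_suml; apply: ler_sum => i _; rewrite -mulrA.
  by rewrite ler_wpM2l ?softmax_ge0//; apply: tilt_sqr => k; exact: close.
have v1 : \sum_j x j * \sum_i v i j ^+ 2 <= 1.
  apply: le_trans xsum; apply: ler_sum => j _.
  rewrite ler_piMr//; under eq_bigr do rewrite exprMn sqv.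
  exact: sum_sqr_centered.
pose sep (a b : I -> R) := 6 < wsq x (fun j => comb v (h a) j - comb v (h b) j).
have [|s [sN sQ smax]] := @maximal_separated R (I -> R) Q sep (9 * expR lam).
  move=> s sQ sp; apply: (@packing R I J x v lam _ (fun l => h (nth c s (val l)))) => //.
    by move=> l; apply: hlam; apply: sQ; apply: mem_nth; exact: ltn_ord.
  have sp' := pairwiseP c sp.
  move=> l k lk.
  have [lt|lt|/val_inj e] := ltngtP (val l) (val k).
  - by have /asboolP := sp' _ _ (ltn_ord l) (ltn_ord k) lt.
  - have /asboolP := sp' _ _ (ltn_ord k) (ltn_ord l) lt.
    rewrite /sep /wsq => H; apply: lt_le_trans H _; apply: ler_sum => j _.
    by rewrite -sqrrN opprB.
  - by rewrite e eqxx in lk.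
exists s; split=> // a Qa; have [b bs nsep] := smax a Qa; exists b => //.
have Qb := sQ _ bs.
have wx : wsq x (fun j => halfstep bt S a j - halfstep bt S b j) <=
    6 * bt ^+ 2 / lam * (r * e4).
  have kb : 0 < (kap / bt) ^+ 2 by rewrite exprn_gt0 ?divr_gt0.
  rewrite -(ler_pM2l kb).
  have -> : (kap / bt) ^+ 2 * (6 * bt ^+ 2 / lam * (r * e4)) = 6.
    by rewrite expr_div_n kap2; field; rewrite !gt_eqF.
  apply: le_trans (_ : wsq x (fun j => comb v (h a) j - comb v (h b) j) <= _);
    last by rewrite leNgt; apply/negP.
  rewrite /wsq mulr_sumr; apply: ler_sum => j _; rewrite !combE.
  by rewrite le_eqVlt; apply/orP; left; apply/eqP; ring.
have shift j : `|halfstep bt S b j - halfstep bt S c j| <= bt * (2 * (s0 * expR (1 + 1))).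
  rewrite halfstepB normrM gtr0_norm// ler_pM2l//.
  under eq_bigr do rewrite -mulrA.
  apply: mean_bound; [exact: softmax_ge0|exact: softmax_sum|] => i.
  rewrite normrM mulrC ler_pM//.
    rewrite /centered; apply: le_trans (ler_normB _ _) _.
    rewrite -[leRHS]/(1 + 1) lerD//; apply: mean_bound => //.
      exact: softmax_ge0.
    exact: softmax_sum.
  have p0 : 0 <= s0 * expR (1 + 1) by rewrite mulr_ge0 ?expR_ge0// ltW.
  rewrite -[leRHS]ger0_norm// -ler_sqr ?nnegrE// !real_normK ?num_real//.
  apply: le_trans (tilt_sqr i (fun k => close b k Qb)) _.
  rewrite exprMn; apply: ler_pM; rewrite ?sqr_ge0 ?expR_ge0//.
    rewrite -[leLHS]real_normK ?num_real// ler_sqr ?nnegrE // ?(ltW s00)//.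
    exact: close.
  by rewrite expr2 -expRD ler_expR; lra.
apply: le_trans (_ : wsq x (fun j => halfstep bt S a j - halfstep bt S b j) *
   expR (bt * (2 * (s0 * expR (1 + 1))) + bt * (2 * (s0 * expR (1 + 1)))) <= _).
  rewrite /wsq mulr_suml; apply: ler_sum => j _; rewrite [leRHS]mulrAC.
  by rewrite ler_wpM2r ?sqr_ge0//; exact: softmax_ratio.
set E2 := expR (_ + _).
have E20 : 0 < E2 by exact: expR_gt0.
have EE : e4 * E2 <= 1 + eta.
  rewrite -expRD -[leRHS]lnK ?posrE ?addr_gt0// ler_expR -/del.
  by apply: le_trans s0K; rewrite /K; lra.
apply: le_trans (_ : 6 * bt ^+ 2 / lam * (r * e4) * E2 <= _).
  by apply: ler_wpM2r => //; exact: ltW.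
have -> : 6 * bt ^+ 2 / lam * (r * e4) * E2 =
  (e4 * E2) * (6 * bt ^+ 2 / lam * r) by ring.
have -> : (1 + eta) * (6 * bt ^+ 2) / lam * r =
  (1 + eta) * (6 * bt ^+ 2 / lam * r) by ring.
by rewrite ler_wpM2r// !mulr_ge0 ?invr_ge0 ?sqr_ge0// ltW.
Qed.

End HalfCover.

(** * Linear functionals avoiding small values *)
Section Avoid.
Context {R : realType}.
Implicit Types F : finType.

(** Two solutions t differ by at most 2 * sg * Q / kap. *)
Lemma card_progression_small (Q : nat) (A c sg kap : R) :
  0 < kap -> 0 <= sg -> kap <= `|c| ->
  #|[set t : 'I_Q | `|A + (t : nat)%:R / Q%:R * c| <= sg]%SET|%:R
    <= 2 * sg * Q%:R / kap + 1.
Proof.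
move=> kap0 sg0 kc; set T := finset _.
have [->|/set0Pn[t1 t1T]] := eqVneq T finset.set0.
  by rewrite cards0 addr_ge0// divr_ge0 ?mulr_ge0// ltW.
have Q0 : (0 < Q)%N by case: (Q) t1 {t1T T} => // -[].
have Q0' : 0 < Q%:R :> R by rewrite ltr0n.
case: (arg_minnP (fun t : 'I_Q => t : nat) t1T) => t0 mt0 tmin.
have t0T : t0 \in T := mt0.
set w := 2 * sg * Q%:R / kap.
have w0 : 0 <= w by rewrite divr_ge0 ?mulr_ge0// ltW.
have diff (t : 'I_Q) : t \in T -> (t - t0 <= Num.truncn w)%N.
  move=> tT; have le0 := tmin _ tT.
  rewrite truncn_ge_nat//.
  rewrite natrB// /w ler_pdivlMr//.
  move: tT t0T; rewrite /T !inE => tT t0T.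
  have : `|(t%:R - t0%:R) / Q%:R * c| <= 2 * sg.
    have -> : (t%:R - t0%:R) / Q%:R * c =
      (A + t%:R / Q%:R * c) - (A + t0%:R / Q%:R * c) by ring.
    by apply: le_trans (ler_normB _ _) _; lra.
  have d0 : 0 <= (t%:R - t0%:R : R) by rewrite subr_ge0 ler_nat.
  rewrite normrM ger0_norm ?divr_ge0//.
  rewrite mulrAC ler_pdivrMr// => H; apply: le_trans H.
  by rewrite ler_wpM2l.
have : (#|T| <= (Num.truncn w).+1)%N.
  rewrite cardE -(size_map (fun t : 'I_Q => (t - t0)%N)).
  rewrite -(size_iota 0 (Num.truncn w).+1); apply: uniq_leq_size.
    rewrite map_inj_in_uniq ?enum_uniq// => x y.
    rewrite !mem_enum => xT yT e; apply: val_inj.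
    by rewrite /= -(subnK (tmin _ xT)) e subnK// tmin.
  move=> _ /mapP[t + ->]; rewrite mem_enum mem_iota add0n ltnS => /diff.
  by move->.
rewrite -(ler_nat R) => H; apply: le_trans H _.
by rewrite -natr1 lerD2r truncn_le.
Qed.

Definition upd F (Q : nat) (g : {ffun F -> 'I_Q}) (p0 : F) (t : 'I_Q) :
  {ffun F -> 'I_Q} := [ffun p => if p == p0 then t else g p].

(** Exchanging the resampled coordinate with the new value is an involution of
    the pairs, so resampling preserves the uniform law. *)
Lemma sum_upd F (Q : nat) (p0 : F) (f : {ffun F -> 'I_Q} -> R) :
  \sum_g \sum_t f (upd g p0 t) = Q%:R * \sum_g f g.
Proof.
rewrite pair_bigA /=.
pose h (p : {ffun F -> 'I_Q} * 'I_Q) := (upd p.1 p0 p.2, p.1 p0).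
have hK : involutive h.
  move=> [g t]; rewrite /h /=; congr pair; last by rewrite ffunE eqxx.
  by apply/ffunP => p; rewrite !ffunE; case: eqP => // ->.
transitivity (\sum_(p : {ffun F -> 'I_Q} * 'I_Q) f p.1).
  by rewrite [RHS](reindex_inj (inv_inj hK)).
rewrite -(pair_bigA _ (fun g (t : 'I_Q) => f g)) /= mulr_sumr.
by apply: eq_bigr => g _; rewrite sumr_const card_ord mulr_natl.
Qed.

Definition small_on F (sg : R) (g : F -> R) (c : F -> R) :=
  `|\sum_p g p * c p| <= sg.

(** Averaging over a fine grid in the unit cube: conditionally on the other
    coordinates of the functional, the coordinate at which [c] is at least kap
    makes the value small with probability at most 2 * sg / kap + 1 / Q. *)
Lemma avoid_row F (kap sg : R) (s : seq (F -> R)) :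
  0 < kap -> 0 < sg ->
  (forall c, c \in s -> exists p, kap <= `|c p|) ->
  exists g : F -> R, [/\ forall p, 0 <= g p <= 1 &
    (count (small_on sg g) s)%:R <= 3 * sg / kap * (size s)%:R].
Proof.
move=> kap0 sg0 big.
(* With Q at least kap / sg the discretisation error 1 / Q costs one more
   sg / kap, whence the constant 3. *)
pose Q := (Num.bound (kap / sg)).+1.
have Q0 : 0 < Q%:R :> R by rewrite ltr0n.
have kQ : kap / sg <= Q%:R.
  apply/ltW; apply: lt_le_trans (archi_boundP _) _; rewrite ?ler_nat//.
  by rewrite divr_ge0// ltW.
pose ev (g : {ffun F -> 'I_Q}) p : R := (g p : nat)%:R / Q%:R.
pose N : R := #|{ffun F -> 'I_Q}|%:R.
have N0 : 0 < N by rewrite ltr0n; apply/card_gt0P; exists [ffun=> ord0].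
have each c : (exists p, kap <= `|c p|) ->
    \sum_g (small_on sg (ev g) c : nat)%:R <= 3 * sg / kap * N.
  move=> [p0 kp]; rewrite -(ler_pM2l Q0) -(sum_upd p0).
  rewrite [leRHS](_ : _ = \sum_(g : {ffun F -> 'I_Q}) (3 * sg * Q%:R / kap)); last first.
    rewrite sumr_const -[_ *+ #|_|]mulr_natr -/N; field; exact: lt0r_neq0.
  apply: ler_sum => g _.
  apply: (@le_trans _ _ (2 * sg * Q%:R / kap + 1)); last first.
    have -> : 3 * sg * Q%:R / kap = 2 * sg * Q%:R / kap + sg * Q%:R / kap.
      by field; exact: lt0r_neq0.
    rewrite lerD2l ler_pdivlMr// mul1r mulrC -ler_pdivrMr//.
  pose A := \sum_(p | p != p0) ev g p * c p.
  apply: le_trans (card_progression_small Q A kap0 (ltW sg0) kp).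
  rewrite -sum1_card natr_sum [leRHS]big_mkcond; apply: ler_sum => t _.
  rewrite /small_on (bigD1 p0) //= inE.
  have -> : ev (upd g p0 t) p0 * c p0 = (t : nat)%:R / Q%:R * c p0.
    by rewrite /ev ffunE eqxx.
  have -> : \sum_(p | p != p0) ev (upd g p0 t) p * c p = A.
    by apply: eq_bigr => p /negPf pp; rewrite /ev ffunE pp.
  by rewrite addrC; case: ifP.
have tot : \sum_g (count (small_on sg (ev g)) s)%:R <=
    \sum_(g : {ffun F -> 'I_Q}) 3 * sg / kap * (size s)%:R.
  rewrite sumr_const -[_ *+ #|_|]mulr_natr -/N.
  rewrite [leLHS](_ : _ = \sum_(c <- s) \sum_g (small_on sg (ev g) c : nat)%:R).
    have -> : 3 * sg / kap * (size s)%:R * N = \sum_(c <- s) 3 * sg / kap * N.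
      by rewrite big_const_seq count_predT iter_addr_0 -mulr_natr; ring.
    by rewrite big_seq [leRHS]big_seq; apply: ler_sum => c cs; exact/each/big.
  rewrite exchange_big; apply: eq_bigr => g _ /=.
  by rewrite -natr_sum -sum1_count big_mkcond /=; congr _%:R; apply: eq_bigr => c _; case: ifP.
have [g gP] : exists g : {ffun F -> 'I_Q},
    (count (small_on sg (ev g)) s)%:R <= 3 * sg / kap * (size s)%:R.
  apply: contrapT => /forallNP H; move: tot; apply/negP; rewrite -ltNge.
  apply: ltr_sum => [|g _]; last by rewrite ltNge; apply/negP/H.
  by apply/hasP; exists [ffun=> ord0] => //; rewrite mem_index_enum.
exists (ev g); split => // p; rewrite /ev divr_ge0//= ler_pdivrMr// mul1r ler_nat.
exact: ltnW.
Qed.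

(** Each row of [avoid_row] removes all but a fraction 3 * sg / kap of the
    vectors not yet dealt with. *)
Lemma avoid_rows F (kap sg : R) (M : nat) (s : seq (F -> R)) :
  0 < kap -> 0 < sg ->
  (forall c, c \in s -> exists p, kap <= `|c p|) ->
  (size s)%:R * (3 * sg / kap) ^+ M < 1 ->
  exists g : nat -> F -> R, (forall l p, 0 <= g l p <= 1) /\
    forall c, c \in s -> exists2 l, (l < M)%N & ~~ small_on sg (g l) c.
Proof.
move=> kap0 sg0; elim: M s => [|M IH] s big.
  rewrite expr0 mulr1 -[ltRHS]/(1%:R) ltr_nat ltnS leqn0 size_eq0 => /eqP ->.
  by exists (fun _ _ => 0); split => // l p; rewrite lexx ler01.
move=> sM.
have [g [g01 gc]] := avoid_row kap0 sg0 big.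
have [||g' [g'01 g's]] := IH (seq.filter (small_on sg g) s).
- by move=> c; rewrite mem_filter => /andP[_ /big].
- apply: le_lt_trans sM; rewrite size_filter exprS mulrA.
  apply: ler_wpM2r; first by rewrite exprn_ge0 ?divr_ge0 ?mulr_ge0 // ltW.
  by rewrite [leRHS]mulrC.
exists (fun l => if l is l'.+1 then g' l' else g); split; first by case.
move=> c cs; have [sm|sm] := boolP (small_on sg g c); last by exists 0%N.
have [|l lM gl] := g's c; first by rewrite mem_filter sm.
by exists l.+1.
Qed.

End Avoid.

(** * Coverings and non-vanishing along the iteration *)
Section Iterate.
Context {R : realType}.

Lemma size_flatten_map_le (T U : eqType) (f : T -> seq U) (s : seq T) (N : R) :
  (forall x, x \in s -> (size (f x))%:R <= N) ->
  (size (flatten [seq f x | x <- s]))%:R <= (size s)%:R * N.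
Proof.
elim: s => [|x s IH] fN /=; first by rewrite mul0r.
rewrite size_cat natrD -addn1 natrD addrC mulrDl mul1r lerD ?fN ?mem_head//.
by apply: IH => y ys; apply: fN; rewrite inE ys orbT.
Qed.

Lemma two_geometric (q1 q2 B1 B2 e1 e2 : R) :
  0 <= q1 < 1 -> 0 <= q2 < 1 -> 0 < e1 -> 0 < e2 ->
  exists k : nat, B1 * q1 ^+ k < e1 /\ B2 * q2 ^+ k < e2.
Proof.
have H (q B e : R) : 0 <= q < 1 -> 0 < e -> \forall k \near \oo, B * q ^+ k < e.
  move=> /andP[q0 q1'] e0.
  have cv : (B * q ^+ k) @[k --> \oo] --> B * 0.
    by apply: cvgMr; apply: cvg_expr; rewrite ger0_norm.
  rewrite mulr0 in cv; exact: (cvgr_lt _ cv).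
move=> q1h q2h e1h e2h; near \oo => k; exists k.
by split; near: k; apply: H.
Unshelve. all: by end_near. Qed.

Lemma box_net (F : finType) (be r : R) : 0 < be -> 0 < r ->
  exists s : seq (F -> R), (forall b, b \in s -> box be b) /\
    forall a, box be a -> exists2 b, b \in s & forall p, `|a p - b p| <= r.
Proof.
move=> be0 r0; pose n := (Num.bound (2 * be / r)).+1.
have n0 : 0 < n%:R :> R by rewrite ltr0n.
have nr : 2 * be / r <= n%:R.
  apply/ltW; apply: lt_le_trans (archi_boundP _) _; rewrite ?ler_nat//.
  by rewrite divr_ge0 ?mulr_ge0// ltW.
pose pt (g : {ffun F -> 'I_n.+1}) (p : F) : R :=
  - be + 2 * be * ((g p : nat)%:R / n%:R).
exists [seq pt g | g <- enum {ffun F -> 'I_n.+1}]; split.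
  move=> _ /mapP[g _ ->] p; rewrite /pt ler_norml.
  have : 0 <= ((g p : nat)%:R / n%:R : R) <= 1.
    by rewrite divr_ge0//= ler_pdivrMr// mul1r ler_nat -ltnS.
  by move=> /andP[]; set x := _ / _ => x0 x1; apply/andP; split; nra.
move=> a ba.
pose y p := (a p + be) / (2 * be) * n%:R.
have y0 p : 0 <= y p <= n%:R.
  have := ba p; rewrite ler_norml => /andP[l u].
  apply/andP; split; rewrite /y.
    by apply: mulr_ge0; [apply: divr_ge0; lra|exact: ltW].
  by apply: ler_piMl; [exact: ltW|rewrite ler_pdivrMr; lra].
pose g : {ffun F -> 'I_n.+1} := [ffun p => inord (Num.truncn (y p))].
exists (pt g); first by apply: map_f; rewrite mem_enum.
move=> p; have /andP[y0p ynp] := y0 p.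
have gE : (g p : nat) = Num.truncn (y p).
  by rewrite ffunE inordK// ltnS -(ler_nat R); apply: le_trans ynp; rewrite truncn_le.
have /andP[t1 t2] := truncn_itv y0p.
have aE : a p = - be + 2 * be * (y p / n%:R).
  by rewrite /y; field; rewrite !gt_eqF.
rewrite {1}aE /pt gE.
have -> : - be + 2 * be * (y p / n%:R) -
    (- be + 2 * be * ((Num.truncn (y p))%:R / n%:R)) =
    (2 * be / n%:R) * (y p - (Num.truncn (y p))%:R).
  by field; rewrite gt_eqF.
have bn : 0 <= 2 * be / n%:R by rewrite divr_ge0 ?mulr_ge0 ?(ltW be0).
have d0 : 0 <= y p - (Num.truncn (y p))%:R by rewrite subr_ge0.
rewrite ger0_norm; last exact: mulr_ge0.
apply: le_trans (_ : 2 * be / n%:R <= _).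
  by apply: ler_piMr => //; rewrite lerBlDl natr1 ltW.
by rewrite ler_pdivrMr// [leRHS]mulrC -ler_pdivrMr.
Qed.

Context {V F : finType} (v0 : V) (f0 : F) (S : V -> F -> R).
Context (S1 : forall u p, `|S u p| <= 1).
Context (be be' : R) (be0 : 0 < be) (be'0 : 0 < be').

Definition mirror (a : F -> R) : F -> R :=
  halfstep be S (halfstep be' (fun p u => S u p) a).

Lemma mirror_box a : box be (mirror a).
Proof. by apply: (halfstep_box v0) => //; exact: ltW. Qed.

Context (lam eta : R) (lam0 : 0 < lam) (eta0 : 0 < eta).

Definition rate : R := (1 + eta) * 6 * be * be' / lam.
Definition mult : R := (9 * expR lam) ^+ 2.

Lemma rate_gt0 : 0 < rate.
Proof. by rewrite divr_gt0// !mulr_gt0// addr_gt0. Qed.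

Lemma mult_gt0 : 0 < mult.
Proof. by rewrite exprn_gt0// mulr_gt0// expR_gt0. Qed.

(** The composite of the two coverings by [halfstep_cover]; the second one is
    applied around each centre of the first. *)
Lemma mirror_cover : exists2 r0 : R, 0 < r0 &
  forall (Q : (F -> R) -> Prop) (c : F -> R) (r : R),
  0 < r <= r0 -> box be c ->
  (forall a, Q a -> wsq (softmax c) (fun i => a i - c i) <= r) ->
  exists s : seq (F -> R), [/\ (size s)%:R <= mult,
    forall b, b \in s -> box be b &
    forall a, Q a -> exists2 b, b \in s &
      wsq (softmax b) (fun p => mirror a p - b p) <= rate ^+ 2 * r].
Proof.
pose St p u := S u p.
have St1 p u : `|St p u| <= 1 by exact: S1.
have [r1 r10 H1] := halfstep_cover f0 be St1 be'0 lam0 eta0.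
have [r2 r20 H2] := halfstep_cover v0 be' S1 be0 lam0 eta0.
pose t1 := (1 + eta) * (6 * be' ^+ 2) / lam.
pose t2 := (1 + eta) * (6 * be ^+ 2) / lam.
have t10 : 0 < t1 by rewrite divr_gt0 ?mulr_gt0 ?addr_gt0 ?exprn_gt0.
have N0 : 0 <= 9 * expR lam by rewrite mulr_ge0 ?expR_ge0.
exists (Num.min r1 (r2 / t1)); first by rewrite lt_min r10 divr_gt0.
move=> Q c r /andP[r0]; rewrite le_min => /andP[rr1 rr2] bc Qr.
have [|s1 [s1N s1Q s1c]] := H1 Q c r _ bc Qr; first by rewrite r0.
pose hf := halfstep be' St.
pose Q2 (l : F -> R) (y : V -> R) := exists2 a, Q a &
  y = hf a /\ wsq (softmax (hf l)) (fun j => hf a j - hf l j) <= t1 * r.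
have /choice[s2 s2P] : forall l, exists s : seq (V -> R),
   [/\ (size s)%:R <= 9 * expR lam,
    forall a, a \in s -> Q2 l a &
    forall a, Q2 l a -> exists2 b, b \in s &
      wsq (softmax (halfstep be S b))
        (fun j => halfstep be S a j - halfstep be S b j)
      <= t2 * (t1 * r)].
  move=> l; apply: (H2 (Q2 l) (hf l)).
  - by rewrite mulr_gt0//= mulrC -ler_pdivlMr.
  - by apply: (halfstep_box f0) => //; exact: ltW.
  - by move=> y [a Qa [-> ]].
exists (flatten [seq [seq halfstep be S y | y <- s2 l] | l <- s1]); split.
- apply: le_trans (size_flatten_map_le (N := 9 * expR lam) _) _.
    by move=> l _; rewrite size_map; have [] := s2P l.
  by rewrite /mult expr2; apply: ler_wpM2r.
- move=> b /flatten_mapP[l ls /mapP[y _ ->]].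
  by apply: (halfstep_box v0) => //; exact: ltW.
- move=> a Qa; have [l ls la] := s1c a Qa.
  have [_ _ /(_ (hf a))] := s2P l; case; first by exists a.
  move=> y ys yP; exists (halfstep be S y).
    by apply/flatten_mapP; exists l => //; exact: map_f.
  apply: le_trans yP _; rewrite le_eqVlt; apply/orP; left; apply/eqP.
  by rewrite /t2 /t1 /rate; field; rewrite gt_eqF.
Qed.

(** The initial covering is a grid, fine enough for the first application of
    [mirror_cover]; as the rate is at most 1 the radius stays admissible. *)
Lemma iter_mirror_cover : rate <= 1 -> exists r0 N0 : R, [/\ 0 < r0, 0 <= N0 &
  forall k, exists s : seq (F -> R), [/\ (size s)%:R <= N0 * mult ^+ k,
    forall b, b \in s -> box be b &
    forall a, box be a -> exists2 b, b \in s &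
      wsq (softmax b) (fun p => iter k mirror a p - b p) <= (rate ^+ 2) ^+ k * r0]].
Proof.
move=> rate1; have rate0 := rate_gt0; have m0 := mult_gt0.
have [r0 r00 H] := mirror_cover.
pose rho := Num.min 1 r0.
have rho0 : 0 < rho by rewrite lt_min ltr01.
have rho2 : rho ^+ 2 <= r0.
  apply: le_trans (_ : rho * 1 <= _).
    by rewrite expr2 ler_wpM2l ?(ltW rho0)// ge_min lexx.
  by rewrite mulr1 ge_min lexx orbT.
have [s0 [s0b s0c]] := @box_net F be rho be0 rho0.
exists r0, (size s0)%:R; split => //; elim=> [|k [s [sN sb sc]]].
  exists s0; split=> //; first by rewrite expr0 mulr1.
  move=> a /s0c[b bs ab]; exists b => //.
  rewrite expr0 mul1r; apply: le_trans rho2.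
  rewrite -[leRHS]mul1r -(softmax_sum f0 b) /wsq mulr_suml.
  apply: ler_sum => p _; rewrite ler_wpM2l ?softmax_ge0//=.
  rewrite -[leLHS]real_normK ?num_real// ler_sqr ?nnegrE ?(ltW rho0)//.
have rk0 : 0 < (rate ^+ 2) ^+ k * r0 by rewrite mulr_gt0// !exprn_gt0.
have rk1 : (rate ^+ 2) ^+ k * r0 <= r0.
  by rewrite ler_piMl ?(ltW r00)// !exprn_ile1 ?exprn_ge0// ltW.
pose Q (c y : F -> R) := exists2 a, box be a & y = iter k mirror a /\
  wsq (softmax c) (fun p => y p - c p) <= (rate ^+ 2) ^+ k * r0.
have /choice[s2 s2P] : forall c, exists s' : seq (F -> R), c \in s ->
   [/\ (size s')%:R <= mult, forall b, b \in s' -> box be b &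
    forall a, Q c a -> exists2 b, b \in s' &
      wsq (softmax b) (fun p => mirror a p - b p)
       <= rate ^+ 2 * ((rate ^+ 2) ^+ k * r0)].
  move=> c; have [cs|cs] := pselect (c \in s); last by exists [::].
  have [||s' s'P] := H (Q c) c ((rate ^+ 2) ^+ k * r0) _ (sb _ cs).
  - by rewrite rk0 rk1.
  - by move=> a [a' _ []].
  - by exists s'.
exists (flatten [seq s2 c | c <- s]); split.
- apply: le_trans (size_flatten_map_le (N := mult) _) _.
    by move=> c /s2P[].
  by rewrite exprSr mulrA; apply: ler_wpM2r => //; exact: ltW.
- by move=> b /flatten_mapP[c /s2P[_ bb _] /bb].
- move=> a ba; have [c cs ca] := sc a ba.
  have [_ _ /(_ (iter k mirror a))] := s2P _ cs; case; first by exists a.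
  move=> b bs bP; exists b; first by apply/flatten_mapP; exists c.
  by rewrite exprS -mulrA iterS.
Qed.

(** After k steps the orbit is within [del] = rate^k * C of the centres, in
    each coordinate, and the relevant centres have a coordinate at least
    kap / 2. Applying [avoid_rows] at the level #|F| * del, which bounds the
    change of a functional between an iterate and its centre, requires that a
    constant times (mult * rate^M)^k be less than 1. *)
Lemma orbit_avoid (D : (F -> R) -> Prop) (kap : R) (M : nat) :
  rate < 1 -> mult * rate ^+ M < 1 -> 0 < kap ->
  (forall a, D a -> box be a) ->
  (forall a k, D a -> exists p, kap <= `|iter k mirror a p|) ->
  exists (k : nat) (g : nat -> F -> R), forall a, D a ->
    exists2 l, (l < M)%N & \sum_p g l p * iter k mirror a p != 0.
Proof.
move=> rate1 mM kap0 Db Dk.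
have rate0 := rate_gt0; have m0 := mult_gt0.
have [r0 [N0 [r00 N00 cov]]] := iter_mirror_cover (ltW rate1).
pose nF : R := #|F|%:R.
have nF0 : 0 < nF by rewrite ltr0n; apply/card_gt0P; exists f0.
pose m : R := expR (- (be + be)) / nF.
have mgt0 : 0 < m by rewrite divr_gt0 ?expR_gt0.
pose C := Num.sqrt (r0 / m).
have C0 : 0 < C by rewrite sqrtr_gt0 divr_gt0.
have C2 : C ^+ 2 = r0 / m by rewrite sqr_sqrtr// ltW// divr_gt0.
have [||||k [k1 k2]] := @two_geometric rate (mult * rate ^+ M)
   C (N0 * (3 * (nF * C) / (kap / 2)) ^+ M) (kap / 2) 1 => //.
- by rewrite (ltW rate0).
- by apply/andP; split => //; apply: ltW; apply: mulr_gt0 => //; exact: exprn_gt0.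
- by rewrite divr_gt0.
have [s [sN sb sc]] := cov k.
pose del := rate ^+ k * C.
have del0 : 0 < del by rewrite mulr_gt0 ?exprn_gt0.
pose sbig := [seq b <- s | `[< exists p, kap / 2 <= `|b p| >]].
have [||||g [g01 gP]] := @avoid_rows R F (kap / 2) (nF * del) M sbig.
- by rewrite divr_gt0.
- by rewrite mulr_gt0.
- by move=> b; rewrite mem_filter => /andP[/asboolP].
- apply: le_lt_trans k2.
  have -> : N0 * (3 * (nF * C) / (kap / 2)) ^+ M * (mult * rate ^+ M) ^+ k =
     N0 * mult ^+ k * (3 * (nF * del) / (kap / 2)) ^+ M.
    set T := 3 * (nF * C) / (kap / 2).
    have -> : 3 * (nF * del) / (kap / 2) = rate ^+ k * T by rewrite /T /del; ring.
    rewrite [(mult * _) ^+ k]exprMn [(rate ^+ k * T) ^+ M]exprMn -(exprM rate) -(exprM rate) mulnC.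
    by ring.
  apply: ler_wpM2r.
    apply: exprn_ge0; apply: divr_ge0; last exact/ltW/divr_gt0.
    by apply: mulr_ge0 => //; apply: mulr_ge0; exact: ltW.
  by apply: le_trans sN; rewrite ler_nat size_filter count_size.
exists k, g => a Da.
have [b bs ab] := sc a (Db a Da).
have near p : `|iter k mirror a p - b p| <= del.
  rewrite -[del]gtr0_norm// -ler_sqr ?nnegrE// !real_normK ?num_real//.
  rewrite -(ler_pM2l mgt0).
  have -> : m * del ^+ 2 = (rate ^+ 2) ^+ k * r0.
    rewrite /del exprMn C2 -!exprM mulnC; field; exact: lt0r_neq0.
  apply: le_trans ab.
  apply: le_trans (_ : softmax b p * (iter k mirror a p - b p) ^+ 2 <= _).
    by rewrite ler_wpM2r ?sqr_ge0//; apply: softmax_lb; exact: sb.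
  rewrite /wsq (bigD1 p) //= lerDl; apply: sumr_ge0 => q _.
  by rewrite mulr_ge0 ?sqr_ge0 ?softmax_ge0.
have bbig : b \in sbig.
  rewrite mem_filter bs andbT; apply/asboolP.
  have [p kp] := Dk a k Da; exists p.
  have := near p; rewrite distrC => np.
  have := lerB_normD (iter k mirror a p) (b p - iter k mirror a p).
  rewrite addrCA subrr addr0.
  have : del <= kap / 2 by apply: ltW; rewrite /del mulrC.
  lra.
have [l lM] := gP b bbig; rewrite -ltNge => gb; exists l => //.
apply/eqP => z; move: gb; rewrite /small_on.
have -> : \sum_p g l p * b p = - \sum_p g l p * (iter k mirror a p - b p).
  under [in RHS]eq_bigr do rewrite mulrBr.
  by rewrite sumrB z sub0r opprK.
apply/negP; rewrite -leNgt normrN.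
apply: le_trans (ler_norm_sum _ _ _) _.
rewrite /nF mulr_natl -sumr_const; apply: ler_sum => p _.
have /andP[g0 g1] := g01 l p.
by rewrite normrM ger0_norm// -[leRHS]mul1r; apply: ler_pM.
Qed.

End Iterate.

(** * The inequality of Gibbs *)
Section Gibbs.
Context {R : realType}.
Implicit Types I : finType.

Definition prob I (x : I -> R) := (forall i, 0 <= x i) /\ \sum_i x i = 1.

Definition entropy I (x : I -> R) : R := - \sum_i x i * ln (x i).

Lemma softmax_prob I (i0 : I) (c : I -> R) : prob (softmax c).
Proof. by split; [exact: softmax_ge0|exact: softmax_sum]. Qed.

(** Nonnegativity of the relative entropy with respect to the softmax law,
    from ln t <= t - 1. *)
Lemma gibbs_le I (x c : I -> R) : prob x ->
  \sum_i x i * c i + entropy x <= ln (partition_sum c).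
Proof.
move=> [x0 x1].
have [i0 _|I0] := pickP (@predT I); last first.
  by move: x1; rewrite big_pred0// => /esym/eqP; rewrite oner_eq0.
have Z0 := partition_sum_gt0 i0 c; set Z := partition_sum c in Z0 *.
have key i : x i * c i - x i * ln (x i) <= expR (c i) / Z - x i + x i * ln Z.
  have := x0 i; rewrite le_eqVlt => /predU1P[<-|xi0].
    by rewrite !mul0r !subr0 addr0 divr_ge0 ?expR_ge0// ltW.
  have t0 : 0 < expR (c i) / (x i * Z) by rewrite divr_gt0 ?expR_gt0 ?mulr_gt0.
  have := @le_ln1Dx R (expR (c i) / (x i * Z) - 1).
  rewrite addrCA subrr addr0 ltrDr => /(_ t0).
  rewrite ln_div ?posrE ?expR_gt0 ?mulr_gt0// expRK lnM ?posrE//.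
  move=> /(ler_wpM2l (ltW xi0)).
  have -> : x i * (expR (c i) / (x i * Z) - 1) = expR (c i) / Z - x i.
    by field; rewrite !gt_eqF.
  by move=> H; rewrite -lerBlDr; apply: le_trans H;
    rewrite le_eqVlt; apply/orP; left; apply/eqP; ring.
rewrite /entropy -sumrB; apply: le_trans (ler_sum _ (fun i _ => key i)) _.
by rewrite big_split sumrB /= -!mulr_suml x1 mul1r divff ?gt_eqF// subrr add0r.
Qed.

Lemma gibbs_softmax I (i0 : I) (c : I -> R) :
  \sum_i softmax c i * c i + entropy (softmax c) = ln (partition_sum c).
Proof.
have Z0 := partition_sum_gt0 i0 c.
rewrite /entropy -sumrB -[RHS]mul1r -(softmax_sum i0 c) mulr_suml.
apply: eq_bigr => i _; rewrite {3}/softmax ln_div ?posrE ?expR_gt0// expRK.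
ring.
Qed.

Lemma entropy_ge0 I (x : I -> R) : prob x -> 0 <= entropy x.
Proof.
move=> [x0 x1]; rewrite /entropy oppr_ge0; apply: sumr_le0 => i _.
rewrite mulr_ge0_le0// ln_le0// -x1 (bigD1 i) //= lerDl.
exact: sumr_ge0.
Qed.

Lemma entropy_le I (x : I -> R) : prob x -> entropy x <= ln #|I|%:R.
Proof.
move=> px; have := gibbs_le (fun=> 0) px.
rewrite big1 ?add0r => [|i _]; last by rewrite mulr0.
by rewrite /partition_sum expR0 sumr_const.
Qed.

End Gibbs.

(** * Monotonicity of the energy *)
Section Ascent.
Context {R : realType} {V F : finType} (v0 : V) (f0 : F) (S : V -> F -> R).
Context (be be' : R) (be0 : 0 < be) (be'0 : 0 < be').

Definition start (x : V -> R) : F -> R := fun p => be * \sum_u x u * S u p.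

(** The maximum over the laws nu on [F] of
    <nu, S x> + H(nu) / be + H(x) / be', attained at [softmax (start x)]. *)
Definition energy (x : V -> R) : R :=
  ln (partition_sum (start x)) / be + entropy x / be'.

Lemma mirror_start a :
  mirror S be be' a = start (softmax (halfstep be' (fun p u => S u p) a)).
Proof. by []. Qed.

(** Alternate maximisation: for nu = [softmax (start x)], replacing [x] by the
    softmax law maximises the functional with nu fixed, and the energy of the
    new point maximises over nu again. *)
Lemma energy_mirror (x : V -> R) : prob x ->
  energy x <= energy (softmax (halfstep be' (fun p u => S u p) (start x))).
Proof.
move=> px; set a := start x; set b := halfstep _ _ _.
pose nu := softmax a.
have bilin (y : V -> R) :
    (\sum_p nu p * start y p) / be = (\sum_u y u * b u) / be'.
  rewrite (_ : \sum_p nu p * start y p = be * \sum_u \sum_p y u * nu p * S u p).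
    rewrite (_ : \sum_u y u * b u = be' * \sum_u \sum_p y u * nu p * S u p).
      by field; rewrite !gt_eqF.
    rewrite mulr_sumr; apply: eq_bigr => u _; rewrite /b /halfstep.
    rewrite mulrCA; congr (_ * _); rewrite mulr_sumr.
    by apply: eq_bigr => p _; rewrite mulrA.
  rewrite exchange_big mulr_sumr; apply: eq_bigr => p _; rewrite /start.
  rewrite mulrCA; congr (_ * _); rewrite mulr_sumr.
  by apply: eq_bigr => u _; rewrite mulrCA mulrA.
rewrite /energy -/a -(gibbs_softmax f0 a) -/nu mulrDl (bilin x).
have Hx := gibbs_le b px.
have Ha := gibbs_le (start (softmax b)) (softmax_prob f0 a).
rewrite -/nu in Ha.
apply: le_trans (_ : (\sum_u softmax b u * b u) / be' + entropy nu / be +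
   entropy (softmax b) / be' <= _); last first.
  by rewrite -(bilin (softmax b)) -mulrDl lerD2r ler_pM2r ?invr_gt0.
rewrite addrAC [leRHS]addrAC lerD2r -!mulrDl ler_pM2r ?invr_gt0//.
by rewrite (gibbs_softmax v0 b).
Qed.

Lemma orbit_energy (x : V -> R) k : prob x -> 1 <= energy x ->
  exists2 y, prob y & iter k (mirror S be be') (start x) = start y /\ 1 <= energy y.
Proof.
move=> px ex; elim: k => [|k [y py [ky ey]]]; first by exists x.
exists (softmax (halfstep be' (fun p u => S u p) (start y))).
  exact: softmax_prob.
rewrite iterS ky; split; first exact: mirror_start.
exact: le_trans ey (energy_mirror py).
Qed.

(** If all scores were less than kap, the logarithm of their partition sum
    would be at most kap + ln #|F|, while the entropy of [y] is at most
    ln #|V|. *)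
Lemma energy_large (y : V -> R) (kap : R) : prob y -> 1 <= energy y ->
  kap + ln #|F|%:R + be * (ln #|V|%:R / be') < be ->
  exists p, kap <= `|start y p|.
Proof.
move=> py ey kapP; apply: contrapT => /forallNP Hn; move: kapP; apply/negP.
rewrite -leNgt.
have n0 : 0 < #|F|%:R :> R by rewrite ltr0n; apply/card_gt0P; exists f0.
have lnZ : ln (partition_sum (start y)) <= kap + ln #|F|%:R.
  rewrite -[kap]expRK -lnM ?posrE ?expR_gt0//.
  rewrite ler_ln ?posrE ?mulr_gt0 ?expR_gt0// ?(partition_sum_gt0 f0)//.
  rewrite mulr_natr -sumr_const; apply: ler_sum => p _; rewrite ler_expR.
  apply: le_trans (ler_norm _) _; apply: ltW; rewrite ltNge.
  by apply/negP; exact: Hn.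
have eV := entropy_le py.
move: ey; rewrite /energy => /(ler_wpM2l (ltW be0)).
rewrite mulr1 mulrDr mulrCA divff ?gt_eqF// mulr1 => H; apply: le_trans H _.
rewrite lerD// ler_pM2l// ler_pM2r ?invr_gt0//.
Qed.

(** The score of a facet carrying [x] is [be]. *)
Lemma energy_start (x : V -> R) (p : F) : prob x ->
  (forall u, x u != 0 -> S u p = 1) -> 1 <= energy x.
Proof.
move=> px xp; rewrite /energy.
have sp : start x p = be.
  rewrite /start -[RHS]mulr1 -px.2; congr (_ * _); apply: eq_bigr => u _.
  by have [->|/xp ->] := eqVneq (x u) 0; rewrite ?mul0r ?mulr1.
rewrite -[leLHS]addr0 lerD//; last by rewrite divr_ge0 ?entropy_ge0// ltW.
rewrite ler_pdivlMr// mul1r -[leLHS]expRK ler_ln ?posrE ?expR_gt0//.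
  rewrite /partition_sum (bigD1 p) //= sp lerDl.
  by apply: sumr_ge0 => q _; exact: expR_ge0.
exact: (partition_sum_gt0 f0).
Qed.

End Ascent.

(** * Numerical estimates *)
Section Constants.
Context {R : realType}.

Lemma expR1_ge : 5 / 2 <= expR 1 :> R.
Proof.
have -> : 1 = 8%:R * (1 / 8) :> R by field.
rewrite expRM_natl.
apply: le_trans (_ : (9 / 8) ^+ 8 <= _); first by rewrite !exprS expr0; lra.
apply: lerXn2r; rewrite ?nnegrE ?expR_ge0//.
by have := expR_ge1Dx (1 / 8 : R); lra.
Qed.

Lemma ln2_ge : 1 / 2 <= ln 2 :> R.
Proof.
rewrite -[leLHS]expRK ler_ln ?posrE ?expR_gt0//.
have H := expR_ge1Dx (- (1 / 2) : R).
have p := expR_gt0 (1 / 2 : R).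
rewrite expRN in H; move: H; rewrite -(ler_pM2r p) mulVf ?gt_eqF//; lra.
Qed.

Lemma ln81_le : ln 81 <= 24 / 5 :> R.
Proof.
have -> : 81 = 3 ^+ 4 :> R by rewrite !exprS expr0; ring.
rewrite lnXn// -[leLHS]mulr_natr.
have e0 := expR_gt0 (1 : R); have eg := expR1_ge.
have : ln 3 <= 6 / 5 :> R.
  have := @le_ln1Dx R (3 / expR 1 - 1).
  rewrite addrCA subrr addr0 ltrDr divr_gt0// => /(_ isT).
  rewrite ln_div ?posrE// expRK.
  have : 3 / expR 1 <= 6 / 5 :> R by rewrite ler_pdivrMr//; lra.
  lra.
lra.
Qed.

End Constants.

(** * Continuity of softmax averages *)
Section Continuity.
Context {R : realType} {T : topologicalType}.

Lemma continuous_sum_fin (I : finType) (P : pred I) (f : I -> T -> R) :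
  (forall i, continuous (f i)) -> continuous (fun t => \sum_(i | P i) f i t).
Proof.
by move=> fc; apply: continuous_big => [|i _]; [exact: add_continuous|exact: fc].
Qed.

Lemma continuous_halfstep (I J : finType) (bt : R) (S : I -> J -> R)
    (y : T -> I -> R) : (forall i, continuous (fun t => y t i)) ->
  forall j, continuous (fun t => halfstep bt S (y t) j).
Proof.
move=> yc j t.
rewrite /halfstep; apply: continuousM; first exact: cst_continuous.
apply: (@continuous_sum_fin _ _ (fun i t => softmax (y t) i * S i j)) => i {}t.
apply: cvgM; last exact: cst_continuous.
have [i0 _|I0] := pickP (@predT I); last by have := I0 i.
apply: cvgM.
  by apply: (@continuous_comp _ _ _ (fun t => y t i) expR);
     [exact: yc|exact: continuous_expR].
apply: cvgV; first by rewrite gt_eqF// (partition_sum_gt0 i).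
apply: (@continuous_sum_fin _ _ (fun k t => expR (y t k))) => k {}t.
by apply: (@continuous_comp _ _ _ (fun t => y t k) expR);
     [exact: yc|exact: continuous_expR].
Qed.

End Continuity.

(** * Odd maps from signed incidences *)
Section Core.
Context {R : realType} {V F : finType} (sV : V -> V) (sF : F -> F).
Context (inc : V -> F -> bool).
Context (sVK : involutive sV) (sFK : involutive sF).
Context (inc_eq : forall u p, inc (sV u) (sF p) = inc u p).
Context (inc_free : forall u p, ~~ (inc u p && inc (sV u) p)).

Definition sign_inc (u : V) (p : F) : R := (inc u p)%:R - (inc (sV u) p)%:R.

Lemma sign_inc_bound u p : `|sign_inc u p| <= 1.
Proof.
rewrite /sign_inc; case: (inc u p); case: (inc _ p);
  by rewrite ?subrr ?subr0 ?sub0r ?normr0 ?normrN ?normr1 ?ler01.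
Qed.

Lemma sign_inc_sV u p : sign_inc (sV u) p = - sign_inc u p.
Proof. by rewrite /sign_inc sVK opprB. Qed.

Lemma sign_inc_sF u p : sign_inc u (sF p) = - sign_inc u p.
Proof. by rewrite /sign_inc inc_eq -{1}(sVK u) inc_eq opprB. Qed.

Lemma sign_inc1 u p : inc u p -> sign_inc u p = 1.
Proof.
by move=> iup; have := inc_free u p; rewrite /sign_inc iup /= => /negPf ->; rewrite subr0.
Qed.

Lemma softmax_comp (I : finType) (s : I -> I) (a : I -> R) i : involutive s ->
  softmax (a \o s) i = softmax a (s i).
Proof.
move=> sK; rewrite /softmax /partition_sum; congr (_ / _).
by rewrite [RHS](reindex_inj (inv_inj sK)).
Qed.

Lemma halfstep_comp (I J : finType) (s : I -> I) (bt : R) (S : I -> J -> R)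
    (a : I -> R) j : involutive s -> (forall i j, S (s i) j = - S i j) ->
  halfstep bt S (a \o s) j = - halfstep bt S a j.
Proof.
move=> sK Ss; rewrite /halfstep -mulrN -sumrN; congr (_ * _).
rewrite (reindex_inj (inv_inj sK)); apply: eq_bigr => i _.
by rewrite softmax_comp// sK Ss mulrN.
Qed.

Lemma mirror_odd (be be' : R) a : a \o sF = \- a ->
  mirror sign_inc be be' (\- a) = \- mirror sign_inc be be' a /\
  mirror sign_inc be be' a \o sF = \- mirror sign_inc be be' a.
Proof.
move=> aF; split; apply/funext => p; rewrite /mirror /=; last first.
  rewrite /halfstep -mulrN -sumrN; congr (_ * _).
  by apply: eq_bigr => u _; rewrite sign_inc_sF mulrN.
rewrite -aF.
have -> : halfstep be' (fun p u => sign_inc u p) (a \o sF) =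
   halfstep be' (fun p u => sign_inc u p) a \o sV.
  apply/funext => u; rewrite halfstep_comp//= ?/halfstep.
    rewrite -mulrN -sumrN; congr (_ * _).
    by apply: eq_bigr => q _; rewrite sign_inc_sV mulrN.
  by move=> q w; exact: sign_inc_sF.
by rewrite halfstep_comp// => u q; exact: sign_inc_sV.
Qed.

Lemma start_odd (be : R) (x : V -> R) :
  start sign_inc be (x \o sV) = \- start sign_inc be x /\
  start sign_inc be x \o sF = \- start sign_inc be x.
Proof.
split; apply/funext => p; rewrite /start /= -mulrN -sumrN; congr (_ * _).
  rewrite (reindex_inj (inv_inj sVK)); apply: eq_bigr => u _.
  by rewrite /= sVK sign_inc_sV mulrN.
by apply: eq_bigr => u _; rewrite sign_inc_sF mulrN.
Qed.

Lemma iter_mirror_odd (be be' : R) k (x : V -> R) :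
  iter k (mirror sign_inc be be') (start sign_inc be (x \o sV)) =
    \- iter k (mirror sign_inc be be') (start sign_inc be x) /\
  iter k (mirror sign_inc be be') (start sign_inc be x) \o sF =
    \- iter k (mirror sign_inc be be') (start sign_inc be x).
Proof.
elim: k => [|k [IH1 IH2]]; first exact: start_odd.
by rewrite !iterS IH1; exact: mirror_odd.
Qed.

Definition on_facet (x : V -> R) :=
  prob x /\ exists p : F, forall u, x u != 0 -> inc u p.

(** The choice of constants. The scales [be] and [be'] are those of
    [energy_large] with room for [kap], the parameter [lam] makes the rate
    exactly 1 / e, and the number m + 1 of functionals exceeds
    2 lam + ln 81 = ln mult. *)
Lemma odd_map_exists : (1 < #|V|)%N -> (1 < #|F|)%N ->
  exists (m : nat) (Th : nat -> (V -> R) -> R),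
  [/\ m%:R <= 24 * expR 1 ^+ 2 * ln (#|V|%:R) * ln (#|F|%:R) :> R,
      forall (T : topologicalType) (y : T -> V -> R),
        (forall u, continuous (fun t => y t u)) ->
        forall l, continuous (fun t => Th l (y t)),
      forall l x, Th l (x \o sV) = - Th l x &
      forall x, on_facet x -> exists2 l, (l < m.+1)%N & Th l x != 0].
Proof.
move=> V1 F1.
have [v0 _] : exists v : V, v \in V by apply/card_gt0P; apply: leq_trans V1.
have [f0 _] : exists p : F, p \in F by apply/card_gt0P; apply: leq_trans F1.
set lV := ln _; set lF := ln _.
have ln_half n : (1 < n)%N -> 1 / 2 <= ln n%:R :> R.
  move=> n1; apply: le_trans ln2_ge _.
  by rewrite ler_ln ?posrE ?ltr0n// ?ler_nat// (leq_trans _ n1).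
have lV2 : 1 / 2 <= lV := ln_half _ V1.
have lF2 : 1 / 2 <= lF := ln_half _ F1.
have e52 := @expR1_ge R.
(* Any sufficiently small h would do. *)
have [h h0 h3] : exists2 h : R, 0 < h & (1 + h) * (1 + h) * (1 + h) <= 27 / 25.
  exists (1 / 40); first by lra.
  have : (1 + 1 / 40) * (1 + 1 / 40) <= 1051 / 1000 :> R by lra.
  by move=> H; apply: le_trans (ler_wpM2r _ H) _; lra.
pose be : R := 2 * (1 + h) * lF.
pose be' : R := 2 * (1 + h) * lV.
have be0 : 0 < be by rewrite !mulr_gt0//; lra.
have be'0 : 0 < be' by rewrite !mulr_gt0//; lra.
pose lam := (1 + h) * 6 * be * be' * expR 1.
have lam0 : 0 < lam by rewrite !mulr_gt0//; lra.
have X0 : 0 < (1 + h) * 6 * be * be'.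
  by do 3![apply: mulr_gt0 => //]; rewrite addr_gt0.
have rateE : rate be be' lam h = expR (- 1).
  by rewrite /rate /lam expRN invfM mulrA divff ?mul1r// gt_eqF.
pose kap := h * lF.
have kap0 : 0 < kap by rewrite mulr_gt0//; lra.
have kapP : kap + lF + be * (lV / be') < be.
  have -> : be * (lV / be') = lF.
    rewrite /be /be'; field; apply/andP; split; apply: lt0r_neq0; lra.
  by rewrite /kap /be; have : 0 < h * lF := kap0; lra.
(* Here 2 lam = 48 (1 + h)^3 X with X = e lV lF, so that 48 (1 + h)^3 is at
   most 51.84, while 24 e is at least 60. The difference of at least 8.16 X
   absorbs ln 81, at most 4.8, because X is at least 5/8. *)
have bound : 2 * lam + ln 81 <= 24 * expR 1 ^+ 2 * lV * lF.
  have l81 := @ln81_le R.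
  have ll : 1 / 4 <= lV * lF by nra.
  have el : 5 / 8 <= expR 1 * (lV * lF) by nra.
  have lamE : 2 * lam = expR 1 * (lV * lF) * (48 * ((1 + h) * (1 + h) * (1 + h))).
    by rewrite /lam /be /be'; ring.
  have -> : 24 * expR 1 ^+ 2 * lV * lF = expR 1 * (lV * lF) * (24 * expR 1) by ring.
  move: el lamE h3 e52 l81.
  move: (expR 1 * (lV * lF)) => X; move: (expR 1) (2 * lam) (ln 81) => e Y Z.
  move: ((1 + h) * _ * _) => c X58 -> c1 e52 Z48.
  have : X * (48 * c) <= X * (1296 / 25) by apply: ler_wpM2l; lra.
  have : X * 60 <= X * (24 * e) by apply: ler_wpM2l; lra.
  lra.
pose B := 2 * lam + ln 81.
have B0 : 0 <= B.
  by rewrite addr_ge0 ?ln_ge0//; [rewrite mulr_ge0// ltW|rewrite ler1n].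
pose m := Num.truncn B.
have /andP[mB Bm] := truncn_itv B0.
have rate1 : rate be be' lam h < 1 by rewrite rateE expR_lt1; lra.
have multP : mult lam * rate be be' lam h ^+ m.+1 < 1.
  rewrite /mult rateE -expRM_natl exprMn -expRM_natl.
  have -> : 9 ^+ 2 = expR (ln 81) :> R.
    by rewrite lnK ?posrE// -natrX.
  rewrite -!expRD expR_lt1; move: Bm; rewrite /B -/m; lra.
pose D (a : F -> R) := exists2 x, on_facet x & a = start sign_inc be x.
have Dbox a : D a -> box be a.
  move=> [x [[x0 x1] _] ->] p; rewrite /start normrM gtr0_norm//.
  rewrite ler_piMr ?(ltW be0)//; apply: mean_bound => // u.
  exact: sign_inc_bound.
have Dk a k : D a -> exists p, kap <= `|iter k (mirror sign_inc be be') a p|.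
  move=> [x [px [p xp]] ->].
  have ex : 1 <= energy sign_inc be be' x.
    by apply: (energy_start f0 be0 be'0 (p := p)) => // u /xp; exact: sign_inc1.
  have [y py [-> ey]] := orbit_energy v0 f0 be0 be'0 k px ex.
  apply: (energy_large f0 be0 be'0 py ey).
  exact: kapP.
have [k [g gP]] := orbit_avoid v0 f0 sign_inc_bound be0 be'0 lam0 h0
  rate1 multP kap0 Dbox Dk.
exists m, (fun l x => \sum_p g l p *
  iter k (mirror sign_inc be be') (start sign_inc be x) p); split.
- exact: le_trans mB bound.
- move=> T y yc l.
  have sc p : continuous (fun t => start sign_inc be (y t) p).
    move=> t; apply: cvgM; first exact: cst_continuous.
    apply: (@continuous_sum_fin _ _ _ _ (fun u t => y t u * sign_inc u p)) => u {}t.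
    by apply: cvgM; [exact: yc|exact: cst_continuous].
  have ic p : continuous (fun t => iter k (mirror sign_inc be be') (start sign_inc be (y t)) p).
    elim: k {gP} p => [|k IH] p; first exact: sc.
    by apply: continuous_halfstep => u; apply: continuous_halfstep.
  apply: continuous_sum_fin => p t.
  by apply: cvgM; [exact: cst_continuous|exact: ic].
- move=> l x; rewrite (iter_mirror_odd be be' k x).1 -sumrN.
  by apply: eq_bigr => p _; rewrite mulrN.
- move=> x fx; have [|l lm gl] := gP (start sign_inc be x); first by exists x.
  by exists l.
Qed.

End Core.

(** * From odd maps to the index *)
Section IndexBound.
Context {R : realType}.

Lemma continuous_row (T : topologicalType) n (f : T -> 'rV[R]_n) :
  (forall i, continuous (fun t => f t 0 i)) -> continuous f.
Proof.
move=> fc t; apply/cvg_mx_entourageP => A entA.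
apply: filter_forall => i; apply: filter_forall => j; rewrite (ord1 i).
have /cvg_entourageP /(_ A entA) := fc j t.
by rewrite !near_simpl; apply: filterS => s sA; rewrite inE.
Qed.

Lemma sqnorm_gt0 n (x : 'rV[R]_n) i : x 0 i != 0 -> 0 < sqnorm x.
Proof.
move=> xi; rewrite /sqnorm (bigD1 i) //=; apply: ltr_pwDl.
  by rewrite exprn_even_gt0.
by apply: sumr_ge0 => j _; exact: sqr_ge0.
Qed.

(** An odd map without zeros is normalised to the sphere. *)
Lemma ind_le (X : topologicalType) (tau : X -> X) (m : nat)
    (Th : nat -> X -> R) :
  [set: X] !=set0 -> (forall l, continuous (Th l)) ->
  (forall l t, Th l (tau t) = - Th l t) ->
  (forall t, exists2 l, (l < m.+1)%N & Th l t != 0) ->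
  (ind R tau <= (m%:R)%:E)%E.
Proof.
move=> X0 Thc Thodd Thn0.
pose v t : 'rV[R]_m.+1 := \row_(l < m.+1) Th l t.
have v0 t : 0 < sqnorm (v t).
  have [l lm nz] := Thn0 t.
  by apply: (@sqnorm_gt0 _ _ (Ordinal lm)); rewrite mxE.
pose w t : 'rV[R]_m.+1 := \row_(l < m.+1) (Th l t / Num.sqrt (sqnorm (v t))).
have wS t : w t \in @unit_sphere R m.+1.
  apply/mem_set; rewrite /unit_sphere /= /sqnorm.
  under eq_bigr do rewrite mxE expr_div_n sqr_sqrtr ?(ltW (v0 t))//.
  rewrite -mulr_suml (_ : \sum_i _ = sqnorm (v t)).
    by rewrite divff// gt_eqF.
  by apply: eq_bigr => i _; rewrite mxE.
have wc : continuous w.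
  apply: continuous_row => i.
  under eq_fun do rewrite mxE.
  move=> t; apply: cvgM; first exact: Thc.
  apply: cvgV; first by rewrite gt_eqF// sqrtr_gt0.
  apply: (@continuous_comp _ _ _ (fun t => sqnorm (v t)) Num.sqrt);
    last exact: sqrt_continuous.
  apply: (@continuous_sum_fin _ _ _ _ (fun i t => v t 0 i ^+ 2)) => j {}t.
  rewrite (_ : (fun t => v t 0 j ^+ 2) = (fun t => Th j t * Th j t)).
    by apply: cvgM; exact: Thc.
  by apply/funext => s; rewrite mxE.
pose f (t : X) : Sph R m := SigSub (wS t).
have fe : equivariant_map tau (@antipode R m) f.
  split.
    apply: (@continuous_comp_initial _ _ _ (set_val : Sph R m -> 'rV[R]_m.+1)).
    exact: wc.
  move=> t; apply: val_inj => /=; apply/rowP => i; rewrite !mxE.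
  have -> : sqnorm (v (tau t)) = sqnorm (v t).
    rewrite -(sqnormN (v t)); congr sqnorm; apply/rowP => j.
    by rewrite !mxE Thodd.
  by rewrite Thodd mulNr.
rewrite /ind; case: pselect => [X0'|//].
case: pselect => [ex|nex]; last first.
  by exfalso; apply: nex; exists m; apply/asboolP; exists f.
rewrite lee_fin ler_nat; case: ex_minnP => k _; apply.
by apply/asboolP; exists f.
Qed.

(** The common core of both cases: [y] plays the role of barycentric
    coordinates. As the space is nonempty, some facet has a vertex, and
    neither is fixed by the involution, so that both logarithms are positive. *)
Lemma ind_le_log (X : topologicalType) (tau : X -> X)
    (V F : finType) (sV : V -> V) (sF : F -> F) (inc : V -> F -> bool)
    (y : X -> V -> R) :
  [set: X] !=set0 ->
  involutive sV -> involutive sF ->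
  (forall u p, inc (sV u) (sF p) = inc u p) ->
  (forall u p, ~~ (inc u p && inc (sV u) p)) ->
  (forall u, continuous (fun t => y t u)) ->
  (forall t, y (tau t) = y t \o sV) ->
  (forall t, on_facet inc (y t)) ->
  (ind R tau <=
     (24 * expR 1 ^+ 2 * ln (#|V|%:R) * ln (#|F|%:R))%:E)%E.
Proof.
move=> X0 sVK sFK ie inf yc yeq yf.
have [t0 _] := X0; have [[y0 y1] [p yp]] := yf t0.
have [u0 u0n] : exists u, y t0 u != 0.
  apply: contrapT => /forallNP H; have := y1.
  rewrite big1 ?(rwP eqP) 1?eq_sym ?oner_eq0// => u _.
  by apply/eqP/negPn/negP; exact: H.
have u0p := yp _ u0n.
have V1 : (1 < #|V|)%N.
  apply/card_gt1P; exists u0, (sV u0); split=> //.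
  by apply/negP => /eqP e; have := inf u0 p; rewrite -e u0p.
have F1 : (1 < #|F|)%N.
  apply/card_gt1P; exists p, (sF p); split=> //.
  apply/negP => /eqP e; have := inf u0 p; rewrite u0p /= => /negP; apply.
  by rewrite e ie.
have [m [Th [mB Thc Tho Thn]]] := @odd_map_exists R V F sV sF inc sVK sFK ie inf V1 F1.
apply: le_trans (_ : (m%:R)%:E <= _)%E; last by rewrite lee_fin.
apply: (@ind_le X tau m (fun l t => Th l (y t))) => //.
- by move=> l; exact: Thc.
- by move=> l t; rewrite yeq Tho.
- by move=> t; exact: Thn.
Qed.

End IndexBound.

(** * Simplicial complexes *)
Section Simplicial.
Context {R : realType} {V : finType} (K : simplicial_complex V).
Context (sigma : V -> V) (sK : simplicial_map K K sigma).
Context (sigK : involutive sigma).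

Lemma facet_imset (s : {set V}) :
  s \in facets K -> (sigma @: s)%SET \in facets K.
Proof.
have im2 (t : {set V}) : (sigma @: (sigma @: t))%SET = t.
  rewrite -imset_comp (eq_imset _ (g := id)) ?imset_id// => x /=; exact: sigK.
rewrite !inE => /maxsetP[sKs smax]; apply/maxsetP; split; first exact: sK.
move=> t tK st; have e : (sigma @: t)%SET = s.
  apply: smax; first exact: sK.
  by rewrite -[s]im2; exact: imsetS.
by rewrite -[LHS]im2 e.
Qed.

Lemma simplex_facet (s : {set V}) : s \in simplices K ->
  exists2 t, t \in facets K & s \subset t.
Proof.
move=> sKs; have [t tmax st] := maxset_exists (P := fun t => t \in simplices K) sKs.
by exists t => //; rewrite inE.
Qed.

(** The fibre of an involution over [w] is the point [sigma w]. *)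
Lemma push_involution (a : {ptws V -> R}) w : push sigma a w = a (sigma w).
Proof.
rewrite /push (big_pred1 (sigma w))// => v /=.
by apply/eqP/eqP => [<-|->]; rewrite sigK.
Qed.

Lemma realization_prob (a : realization R K) : prob (set_val a : V -> R).
Proof. by have [? ? _] : realization_set K (set_val a) by exact: set_valP. Qed.

Lemma realization_support (a : realization R K) :
  [set v | set_val a v != 0]%SET \in simplices K.
Proof. by have [_ _ ?] : realization_set K (set_val a) by exact: set_valP. Qed.

Lemma edge_point_subproof (u w : V) : [set u; w]%SET \in simplices K ->
  ((fun v => ((v == u)%:R + (v == w)%:R) / 2) : {ptws V -> R})
    \in realization_set K.
Proof.
move=> uwK; apply/mem_set; split.
- by move=> v; rewrite divr_ge0// addr_ge0.
- rewrite -mulr_suml big_split /=.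
  have one (x : V) : \sum_v (v == x)%:R = 1 :> R.
    by rewrite (bigD1 x) //= eqxx big1 ?addr0// => v /negPf ->.
  by rewrite !one; lra.
- suff -> : [set v | ((v == u)%:R + (v == w)%:R) / 2 != 0 :> R]%SET =
      [set u; w]%SET by [].
  apply/setP => v; rewrite !inE mulf_eq0 invr_eq0 pnatr_eq0 orbF -natrD pnatr_eq0.
  by case: (v == u); case: (v == w).
Qed.

(** The midpoint of an edge, or the vertex itself when it is fixed, would be a
    fixed point. *)
Lemma invariant_edge (u : V) :
  (forall a : realization R K, realization_map sK a <> a) ->
  [set u; sigma u]%SET \notin simplices K.
Proof.
move=> free; apply/negP => uK.
apply: (free (SigSub (edge_point_subproof uK))).
apply: val_inj; apply/funext => v; rewrite [LHS]push_involution /=.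
have e1 : (sigma v == u) = (v == sigma u).
  by apply/eqP/eqP => [<-|->]; rewrite sigK.
have e2 : (sigma v == sigma u) = (v == u) by rewrite (inj_eq (inv_inj sigK)).
change (((sigma v == u)%:R + (sigma v == sigma u)%:R) / 2 =
   ((v == u)%:R + (v == sigma u)%:R) / 2 :> R).
by rewrite e1 e2 addrC.
Qed.

Lemma simplicial_ind_le : (0 < #|V|)%N ->
  (forall a : realization R K, realization_map sK a <> a) ->
  (ind R (realization_map (R := R) sK) <=
     (24 * expR 1 ^+ 2 * ln (#|V|%:R) * ln (#|facets K|%:R))%:E)%E.
Proof.
move=> V0 free.
pose F := {s : {set V} | s \in facets K}.
have <- : #|{: F}| = #|facets K| by rewrite card_sig.
pose sF (p : F) : F := exist (fun s : {set V} => s \in facets K) _ (facet_imset (valP p)).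
have facetK (p : F) : val p \in simplices K.
  by have := valP p; rewrite inE => /maxsetP[].
apply: (@ind_le_log R _ _ V F sigma sF (fun u p => u \in val p)
   (fun (a : realization R K) u => (set_val a : V -> R) u)).
- have [v _] : exists v : V, v \in V by apply/card_gt0P.
  have vK : [set v; v]%SET \in simplices K.
    by rewrite finset.setUid; exact: simplex_vertex.
  by exists (SigSub (edge_point_subproof vK)).
- exact: sigK.
- move=> p; apply: val_inj => /=.
  by rewrite -imset_comp (eq_imset _ (g := id)) ?imset_id// => x /=; exact: sigK.
- by move=> u p; rewrite /= mem_imset//; exact: inv_inj.
- move=> u p; apply/negP => /andP[up sup].
  have /negP := invariant_edge u free; apply.
  apply: simplex_face (facetK p) _ _.
    by apply/fintype.subsetP => w; rewrite !inE => /pred2P[] ->.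
  by apply/finset.set0Pn; exists u; rewrite !inE eqxx.
- move=> u a.
  apply: (@continuous_comp _ _ _ (set_val : realization R K -> {ptws V -> R})
    (fun f : {ptws V -> R} => f u)); first exact: initial_continuous.
  exact: proj_continuous.
- by move=> a; apply/funext => w; rewrite [LHS]push_involution.
- move=> a; split; first exact: realization_prob.
  have [t tf st] := simplex_facet (realization_support a).
  exists (exist _ t tf) => u au; apply: (fintype.subsetP st).
  by rewrite inE.
Qed.

End Simplicial.

(** * The cubical labelling lemma of Kuhn *)
Section Kuhn.
Context (n p : nat).
Let P := 'I_n -> nat.

Definition step (q : P) (d : 'I_n) : P := fun i => (q i + (i == d))%N.

Lemma stepC q d d' : step (step q d) d' = step (step q d') d.
Proof. by apply/funext => i; rewrite /step addnAC. Qed.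

(** The product of the differentials of the [fs], evaluated modulo 2 on the unit
    cube at [q] spanned by the directions in [D]: the sum, over the monotone
    lattice paths through that cube, of the product of the successive
    increments of the functions. *)
Fixpoint kuhn (fs : seq (P -> 'F_2)) (D : {set 'I_n}) (q : P) : 'F_2 :=
  if fs is f :: fs' then
    \sum_(d in D) (f (step q d) + f q) * kuhn fs' (D :\ d)%SET (step q d)
  else 1.

Lemma F2_addxx (x : 'F_2) : x + x = 0.
Proof. by rewrite -mulr2n -mulr_natl pchar_Zp// mul0r. Qed.

Lemma F2_eq (x y : 'F_2) : x + y = 0 -> x = y.
Proof. by move=> xy; rewrite -[x]addr0 -(F2_addxx y) addrA xy add0r. Qed.

Lemma sum_pairs_swap (D : {set 'I_n}) (G : 'I_n -> 'I_n -> 'F_2) :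
  \sum_(d in D) \sum_(e in (D :\ d)%SET) G d e =
  \sum_(d in D) \sum_(e in (D :\ d)%SET) G e d.
Proof.
rewrite (exchange_big_dep (mem D)) /=; last by move=> d e _; rewrite !inE => /andP[].
apply: eq_bigr => d dD; apply: eq_bigl => e.
by rewrite !inE dD andbT eq_sym andbC.
Qed.

Lemma sum_pairs_sym (D : {set 'I_n}) (G : 'I_n -> 'I_n -> 'F_2) :
  (forall d e, G d e = G e d) ->
  \sum_(d in D) \sum_(e in (D :\ d)%SET) G d e = 0.
Proof.
move=> Gsym.
have -> : \sum_(d in D) \sum_(e in (D :\ d)%SET) G d e =
    \sum_(d in D) \sum_(e in D | (d < e)%N) G d e +
    \sum_(d in D) \sum_(e in D | (e < d)%N) G d e.
  rewrite -big_split; apply: eq_bigr => d _ /=.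
  rewrite (bigID (fun e : 'I_n => (d < e)%N)) /=; congr (_ + _).
    apply: eq_bigl => e; rewrite !inE.
    by case: (ltnP d e) => [de|]; rewrite ?andbF// !andbT -val_eqE gtn_eqF.
  apply: eq_bigl => e; rewrite !inE -val_eqE /=.
  by case: (ltngtP d e) => //=; rewrite ?andbF ?andbT.
rewrite [X in _ + X](exchange_big_dep (mem D)) /=; last by move=> d e _ /andP[eD _]; exact: eD.
rewrite -big_split /= big1// => d dD; rewrite -[X in X + _]addr0.
rewrite [X in _ + 0 + X](_ : _ = \sum_(e in D | (d < e)%N) G d e).
  by rewrite addr0 F2_addxx.
by apply: eq_big => [e|e _]; [rewrite dD andbC|exact: Gsym].
Qed.

(** A product of differentials is closed: its sum over the boundary of a cube
    vanishes. In the expansion, the terms symmetric in the two first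
    directions cancel modulo 2, and the others are instances of the induction
    hypothesis. *)
Lemma kuhn_closed fs (D : {set 'I_n}) q :
  \sum_(d in D) (kuhn fs (D :\ d)%SET (step q d) + kuhn fs (D :\ d)%SET q) = 0.
Proof.
elim: fs D q => [|g gs IH] D q; first by apply: big1 => d _; exact: F2_addxx.
pose K d e q' := kuhn gs (D :\ d :\ e)%SET q'.
have Ksym d e q' : K d e q' = K e d q' by rewrite /K finset.setDDl finset.setUC -finset.setDDl.
rewrite (_ : \sum_(d in D) _ = \sum_(d in D) \sum_(e in (D :\ d)%SET)
   (g (step (step q d) e) * K d e (step (step q d) e) +
    (g (step q d) * K d e (step (step q d) e) + g (step q e) * K d e (step q e)) +
    g q * K d e (step q e))); last first.
  apply: eq_bigr => d _ /=; rewrite -big_split; apply: eq_bigr => e _ /=.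
  by rewrite -/(K d e _) -/(K d e _); ring.
under eq_bigr do rewrite big_split big_split /=.
rewrite big_split big_split /=.
rewrite sum_pairs_sym ?add0r => [|d e]; last by rewrite stepC Ksym.
under eq_bigr do rewrite big_split.
rewrite big_split /= (sum_pairs_swap D (fun d e => g (step q e) * K d e (step q e))).
rewrite -big_split /= big1 ?add0r => [|d _]; last first.
  rewrite -big_split; transitivity (g (step q d) *
    \sum_(e in (D :\ d)%SET) (K d e (step (step q d) e) + K d e (step q d))).
    rewrite mulr_sumr; apply: eq_bigr => e _ /=.
    by rewrite -mulrDr (Ksym e d).
  by rewrite IH mulr0.
have H : \sum_(d in D) \sum_(e in (D :\ d)%SET) K d e (step q e) = 0.
  have := sum_pairs_sym D (fun d e => Ksym d e q).
  suff -> : \sum_(d in D) \sum_(e in (D :\ d)%SET) K d e (step q e) =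
    \sum_(d in D) \sum_(e in (D :\ d)%SET) K d e q by [].
  apply: F2_eq; rewrite -big_split big1// => d _.
  by rewrite -big_split; exact: IH.
under eq_bigr do rewrite -mulr_sumr.
by rewrite -mulr_sumr H mulr0.
Qed.

(** The product of the differential of [f] with a closed form is the
    differential of [f] times that form. *)
Lemma kuhn_stokes f fs (D : {set 'I_n}) q :
  kuhn (f :: fs) D q =
  \sum_(d in D) (f (step q d) * kuhn fs (D :\ d)%SET (step q d) +
                 f q * kuhn fs (D :\ d)%SET q).
Proof.
apply: F2_eq; rewrite /= -big_split /=.
rewrite (_ : \sum_(d in D) _ = \sum_(d in D) f q *
   (kuhn fs (D :\ d)%SET (step q d) + kuhn fs (D :\ d)%SET q)).
  by rewrite -mulr_sumr kuhn_closed mulr0.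
apply: eq_bigr => d _; set a := f (step q d); set k := kuhn _ _ _.
rewrite -[RHS]add0r -(F2_addxx (a * k)); ring.
Qed.

(** The differential of [g] vanishes on a face on which [g] is constant. *)
Lemma kuhn_const (g : P -> 'F_2) fs (D : {set 'I_n}) q d :
  List.In g fs -> d \notin D ->
  (forall r s : P, r d = q d -> s d = q d -> g r = g s) ->
  kuhn fs D q = 0.
Proof.
elim: fs D q => [//|f fs IH] D q /= gfs dD gc; apply: big1 => e eD.
have ed : (step q e) d = q d.
  rewrite /step (_ : (d == e) = false) ?addn0//.
  by apply/negP => /eqP de; rewrite de eD in dD.
case: gfs => [fg|gfs].
  by rewrite fg (gc (step q e) q)// F2_addxx mul0r.
rewrite IH ?mulr0//; first by rewrite !inE negb_and dD orbT.
by move=> r s; rewrite ed; exact: gc.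
Qed.

(** Base points of the unit cubes with directions [D] in the face of the box
    where the other coordinates equal [p]. *)
Definition inbox (D : {set 'I_n}) (q : {ffun 'I_n -> 'I_p.+1}) :=
  [forall i, if i \in D then (q i < p)%N else (q i == p :> nat)].

Definition topt (q : {ffun 'I_n -> 'I_p.+1}) : P := fun i => q i.

(** Modulo 2, the interior contributions in direction [d] cancel in pairs. *)
Lemma telescope_box (D : {set 'I_n}) (Phi : P -> 'F_2) d : (0 < p)%N -> d \in D ->
  \sum_(q | inbox D q) (Phi (step (topt q) d) + Phi (topt q)) =
  \sum_(q | inbox (D :\ d)%SET q) Phi (topt q) +
  \sum_(q | inbox D q && (q d == 0 :> nat)) Phi (topt q).
Proof.
move=> p0 dD.
pose W (q : {ffun 'I_n -> 'I_p.+1}) :=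
  [forall i, (i == d) || (if i \in D then (q i < p)%N else (q i == p :> nat))].
have WD q : inbox D q = W q && (q d != p :> nat).
  apply/forallP/andP => [H|[/forallP H qd] i].
    split; first by apply/forallP => i; rewrite H orbT.
    by have := H d; rewrite dD ltn_neqAle => /andP[].
  have [->|ni] := eqVneq i d; first by rewrite dD ltn_neqAle qd -ltnS ltn_ord.
  by have := H i; rewrite (negPf ni).
have WDd q : inbox (D :\ d)%SET q = W q && (q d == p :> nat).
  apply/forallP/andP => [H|[/forallP H qd] i].
    split; last by have := H d; rewrite !inE eqxx.
    by apply/forallP => i; have := H i; rewrite !inE; case: eqVneq.
  have := H i; rewrite !inE; case: eqVneq => [->|//].
  by rewrite qd.
have W0 q : inbox D q && (q d == 0 :> nat) = W q && (q d == 0 :> nat).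
  rewrite WD -andbA; congr (_ && _).
  have [->|_] := eqVneq (q d : nat) 0%N; last by rewrite andbF.
  by rewrite andbT eq_sym -lt0n.
rewrite big_split /=; apply: F2_eq.
have tot k : \sum_(q | W q) Phi (topt q) =
    \sum_(q | W q && (q d == k :> nat)) Phi (topt q) +
    \sum_(q | W q && (q d != k :> nat)) Phi (topt q).
  by rewrite (bigID (fun q : {ffun 'I_n -> 'I_p.+1} => q d == k :> nat)).
have shift : \sum_(q | inbox D q) Phi (step (topt q) d) =
    \sum_(q | W q && (q d != 0%N :> nat)) Phi (topt q).
  pose up (q : {ffun 'I_n -> 'I_p.+1}) : {ffun 'I_n -> 'I_p.+1} :=
    [ffun i => if i == d then inord (q i).+1 else q i].
  pose dn (q : {ffun 'I_n -> 'I_p.+1}) : {ffun 'I_n -> 'I_p.+1} :=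
    [ffun i => if i == d then inord (q i).-1 else q i].
  have Wup (f : {ffun 'I_n -> 'I_p.+1} -> {ffun 'I_n -> 'I_p.+1}) q :
      (forall i, i != d -> f q i = q i) -> W (f q) = W q.
    move=> fq; apply: eq_forallb => i.
    by case: (eqVneq i d) => //= /fq ->.
  have vi m : (inord m : 'I_p.+1) = (if (m < p.+1)%N then m else 0%N) :> nat.
    by rewrite /inord val_insubd.
  rewrite [RHS](reindex_onto up dn) /=; last first.
    move=> q /andP[_ q0]; apply/ffunP => i; rewrite !ffunE.
    case: (eqVneq i d) => // ->; apply: val_inj => /=.
    have qd1 : ((q d).-1 < p.+1)%N by apply: leq_ltn_trans (leq_pred _) (ltn_ord _).
    by rewrite !vi qd1 prednK ?lt0n// ltn_ord.
  apply: eq_big => [q|q].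
    rewrite WD (Wup up) => [|i /negPf id]; last by rewrite ffunE id.
    case: (W q) => //=; rewrite ffunE eqxx vi.
    have [qp|qp] := eqVneq (q d : nat) p => /=; first by rewrite qp ltnn.
    have qdp : ((q d).+1 < p.+1)%N by rewrite ltnS ltn_neqAle qp -ltnS ltn_ord.
    rewrite qdp /=; apply/esym/eqP/ffunP => i; rewrite !ffunE.
    case: (eqVneq i d) => // ->; apply: val_inj.
    by rewrite /= !vi qdp /= ltn_ord.
  rewrite WD => /andP[_ qp]; congr Phi; apply/funext => i.
  have qdp : ((q d).+1 < p.+1)%N by rewrite ltnS ltn_neqAle qp -ltnS ltn_ord.
  rewrite /step /topt ffunE; case: (eqVneq i d) => [->|_]; last by rewrite addn0.
  by rewrite vi qdp addn1.
rewrite shift.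
have E1 : \sum_(q | inbox D q) Phi (topt q) =
  \sum_(q | W q && ~~ (q d == p :> nat)) Phi (topt q) by apply: eq_bigl => q; exact: WD.
rewrite E1 (eq_bigl _ _ WDd) (eq_bigl _ _ W0).
have := etrans (esym (tot 0%N)) (tot p).
set A0 := \sum_(q | _ && (_ == 0)%N) _; set B0 := \sum_(q | _ && (_ != 0)%N) _.
set Ap := \sum_(q | _ && (_ == p)) _; set Bp := \sum_(q | _ && (_ != p)) _ => H.
have -> : B0 + Bp + (Ap + A0) = (A0 + B0) + (Ap + Bp) by ring.
by rewrite H F2_addxx.
Qed.

(** Induction on the dimension of the box. By [kuhn_stokes] the sum lives on
    its boundary. On the two faces orthogonal to a direction other than [d0]
    one of the remaining functions is constant; on the face [r d0 = 0] the
    function of [d0] vanishes; on the opposite face it is 1 and the sum is that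
    of the previous step. *)
Lemma kuhn_box_sum (f : 'I_n -> P -> 'F_2) (ds : seq 'I_n) :
  (0 < p)%N -> uniq ds ->
  (forall d r, r d = 0%N -> f d r = 0) -> (forall d r, r d = p -> f d r = 1) ->
  \sum_(q | inbox [set:: ds]%SET q)
     kuhn (map f ds) [set:: ds]%SET (topt q) = 1.
Proof.
move=> p0 + f0 f1; elim: ds => [_|d0 ds IH].
  rewrite (big_pred1 [ffun=> ord_max]) //= => q.
  apply/forallP/eqP => [H|-> i]; last by rewrite !inE ffunE.
  by apply/ffunP => i; apply: val_inj; rewrite ffunE; have := H i; rewrite !inE => /eqP.
rewrite cons_uniq => /andP[d0ds uds]; set D := [set:: d0 :: ds]%SET.
have d0D : d0 \in D by rewrite !inE eqxx.
have DD : (D :\ d0)%SET = [set:: ds]%SET.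
  apply/setP => i; rewrite !inE; case: eqVneq => //= ->.
  by apply/esym/negbTE.
rewrite map_cons; under eq_bigr => q _ do rewrite kuhn_stokes.
rewrite exchange_big /=.
pose Phi d (r : P) := f d0 r * kuhn (map f ds) (D :\ d)%SET r.
rewrite (bigD1 d0) //= [X in _ + X]big1 => [|d /andP[dD dd0]]; last first.
  have dds : d \in ds by move: dD; rewrite !inE (negPf dd0).
  have inf : List.In (f d) (map f ds).
    elim: (ds) dds => //= e es IHe; rewrite inE => /predU1P[->|/IHe]; by [left|right].
  rewrite (telescope_box (Phi d) p0 dD) !big1 ?addr0// => q.
    move=> /andP[_ /eqP q0]; rewrite /Phi (@kuhn_const (f d) _ _ _ d) ?mulr0//.
      by rewrite !inE eqxx.
    by move=> r s; rewrite {1 2}/topt q0 => r0 s0; rewrite !f0.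
  move=> /forallP /(_ d); rewrite !inE eqxx /= => /eqP qp.
  rewrite /Phi (@kuhn_const (f d) _ _ _ d) ?mulr0//; first by rewrite !inE eqxx.
  by move=> r s; rewrite {1 2}/topt qp => r0 s0; rewrite !f1.
rewrite addr0 (telescope_box (Phi d0) p0 d0D) [X in _ + X]big1 ?addr0; last first.
  by move=> q /andP[_ /eqP q0]; rewrite /Phi f0 ?mul0r.
rewrite /Phi DD -[RHS](IH uds); apply: eq_bigr => q /forallP /(_ d0).
by rewrite !inE (negPf d0ds) => /eqP qp; rewrite f1 ?mul1r.
Qed.

(** A nonzero term is a path along which each function changes once. *)
Lemma kuhn_witness (fs : seq (P -> 'F_2)) (D : {set 'I_n}) q g :
  kuhn fs D q != 0 -> List.In g fs ->
  exists r s : P, [/\ forall i, (q i <= r i <= q i + (i \in D))%N,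
    forall i, (q i <= s i <= q i + (i \in D))%N & g r != g s].
Proof.
elim: fs D q => [//|f fs IH] D q /= nz gfs.
have [d dD] : exists2 d, d \in D & (f (step q d) + f q) *
    kuhn fs (D :\ d)%SET (step q d) != 0.
  apply: contrapT => H; move/eqP: nz; apply; apply: big1 => d dD.
  by apply: contrapT => nzd; apply: H; exists d => //; exact/eqP.
rewrite mulf_eq0 negb_or => /andP[fd kd].
have stq i : (q i <= step q d i <= q i + (i \in D))%N.
  rewrite /step leq_addr leq_add2l; case: (eqVneq i d) => [->|//].
  by rewrite dD.
case: gfs => [<-|gfs].
  exists (step q d), q; split => //; first by move=> i; rewrite leqnn leq_addr.
  by apply: contraNneq fd => ->; rewrite F2_addxx.
have [r [s [rb sb rs]]] := IH _ _ kd gfs.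
have stp i (x : nat) : (step q d i <= x <= step q d i + (i \in D :\ d)%SET)%N ->
    (q i <= x <= q i + (i \in D))%N.
  move=> /andP[xl xu]; apply/andP; split.
    by apply: leq_trans xl; rewrite leq_addr.
  apply: leq_trans xu _; rewrite /step !inE; case: (eqVneq i d) => [->|_] /=.
    by rewrite dD addn0.
  by rewrite addn0.
by exists r, s; split => // i; [apply: stp; exact: rb|apply: stp; exact: sb].
Qed.

(** The sum of [kuhn_box_sum] for the indicators of the labels is odd, so that
    some unit cube carries a nonzero term. *)
Lemma kuhn_labelling (lab : 'I_n -> P -> bool) : (0 < p)%N ->
  (forall d r, r d = 0%N -> ~~ lab d r) -> (forall d r, r d = p -> lab d r) ->
  exists q : P, (forall i, (q i < p)%N) /\
    forall d, exists r s : P, [/\ forall i, (q i <= r i <= (q i).+1)%N,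
      forall i, (q i <= s i <= (q i).+1)%N, lab d r & ~~ lab d s].
Proof.
move=> p0 l0 l1.
pose f d r : 'F_2 := if lab d r then 1 else 0.
have := @kuhn_box_sum f (enum 'I_n) p0 (enum_uniq _).
have f0 d r : r d = 0%N -> f d r = 0 by move=> /l0 /negPf; rewrite /f => ->.
have f1 d r : r d = p -> f d r = 1 by move=> /l1; rewrite /f => ->.
move=> /(_ f0 f1); set D := [set:: _]%SET => sum1.
have [q qin nz] : exists2 q, inbox D q & kuhn (map f (enum 'I_n)) D (topt q) != 0.
  apply: contrapT => H; move/eqP: sum1; rewrite big1 ?(eq_sym 0) ?oner_eq0// => q qD.
  by apply: contrapT => nz; apply: H; exists q => //; exact/eqP.
have DT i : i \in D by rewrite inE mem_enum.
exists (topt q); split.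
  by move=> i; move/forallP: qin => /(_ i); rewrite DT.
move=> d; have inf : List.In (f d) (map f (enum 'I_n)).
  have : d \in enum 'I_n by rewrite mem_enum.
  elim: (enum 'I_n) => //= e es IHe; rewrite inE => /predU1P[->|/IHe]; by [left|right].
have [r [s [rb sb rs]]] := kuhn_witness nz inf.
have rb' i : (topt q i <= r i <= (topt q i).+1)%N by have := rb i; rewrite DT addn1.
have sb' i : (topt q i <= s i <= (topt q i).+1)%N by have := sb i; rewrite DT addn1.
move: rs; rewrite /f; case: (boolP (lab d r)) => lr; case: (boolP (lab d s)) => ls;
  rewrite ?eqxx// => _.
  by exists r, s.
by exists s, r.
Qed.

End Kuhn.

(** * The fixed point theorem of Brouwer *)
Section Brouwer.
Context {R : realType}.

Lemma compact_cube n :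
  compact [set y : 'rV[R]_n | forall i, `[-1, 1]%classic (y ord0 i)].
Proof.
by apply: (@rV_compact R n (fun=> `[-1, 1]%classic)) => i; exact: segment_compact.
Qed.

(** Label [i] holds at a grid point when the displacement is negative along the
    axis [i], with the boundary values prescribed by [kuhn_labelling], where
    the sign of the displacement is known in the weak sense. Near a cluster
    point of the small cubes so obtained, each coordinate of the displacement
    takes values of both weak signs. *)
Lemma brouwer_cube n (g : 'rV[R]_n -> 'rV[R]_n) : continuous g ->
  (forall x i, `|g x 0 i| <= 1) -> exists x, g x = x.
Proof.
move=> gc g1.
pose pt (p : nat) (q : 'I_n -> nat) : 'rV[R]_n :=
  \row_i (- 1 + 2 * ((q i)%:R / p.+1%:R)).
pose lab p (i : 'I_n) (q : 'I_n -> nat) :=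
  (q i != 0%N) && ((q i == p.+1) || (g (pt p q) 0 i < pt p q 0 i)).
have /choice[qq qqP] : forall p, exists q : 'I_n -> nat,
    (forall i, (q i < p.+1)%N) /\
    forall d, exists r s : 'I_n -> nat, [/\ forall i, (q i <= r i <= (q i).+1)%N,
      forall i, (q i <= s i <= (q i).+1)%N, lab p d r & ~~ lab p d s].
  move=> p; apply: kuhn_labelling => // d r; rewrite /lab => -> //.
  by rewrite eqxx.
pose x p := pt p (qq p).
have xbox p i : `|x p 0 i| <= 1.
  rewrite mxE; have [qlt _] := qqP p.
  have : 0 <= ((qq p i)%:R / p.+1%:R : R) <= 1.
    by rewrite divr_ge0//= ler_pdivrMr ?ltr0n// mul1r ler_nat ltnW.
  by rewrite ler_norml => /andP[]; set y := _ / _ => y0 y1; apply/andP; split; lra.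
have xA : (x @ \oo) [set y | forall i, `[-1, 1]%classic (y ord0 i)].
  exists 0%N => // p _ i /=; rewrite in_itv/=.
  by have := xbox p i; rewrite ler_norml.
have [z [_ zc]] := @compact_cube n (x @ \oo) _ xA.
pose h i (y : 'rV[R]_n) := g y 0 i - y 0 i.
have hc i : continuous (h i).
  move=> y; apply: (@cvgB _ _ _ _ (@nbhs_filter 'rV[R]_n y)).
    exact: (@continuous_comp _ _ _ g (fun M : 'rV[R]_n => M 0 i) y (gc y)
      (@coord_continuous R 1 n 0 i (g y))).
  exact: coord_continuous.
have lab_le p i r : (r i <= p.+1)%N -> lab p i r -> h i (pt p r) <= 0.
  rewrite /lab /h => rp /andP[_ /orP[/eqP ri|]]; last by move=> ?; rewrite subr_le0 ltW.
  rewrite subr_le0 [X in _ <= X]mxE ri divff// mulr1.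
  have := g1 (pt p r) i; rewrite ler_norml => /andP[_]; lra.
have lab_ge p i r : ~~ lab p i r -> 0 <= h i (pt p r).
  rewrite /lab /h negb_and negbK negb_or -leNgt subr_ge0 => /orP[/eqP ri|/andP[]//].
  rewrite [X in X <= _]mxE ri mul0r mulr0 addr0.
  by have := g1 (pt p r) i; rewrite ler_norml => /andP[].
have near_z (B : set 'rV[R]_n) : nbhs z B -> exists p, forall r : 'I_n -> nat,
    (forall i, (qq p i <= r i <= (qq p i).+1)%N) -> B (pt p r).
  move=> /nbhs_ballP[d /= d0 dB].
  have [p pd] : exists p, forall m, (p <= m)%N -> 2 / m.+1%:R < d / 2.
    exists (Num.truncn (4 / d)) => m pm.
    have : 4 / d < m.+1%:R.
      apply: lt_le_trans (truncnS_gt _) _; rewrite ler_nat ltnS//.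
    rewrite ltr_pdivrMr// ltr_pdivrMr ?ltr0n//; lra.
  have [_ [[m pm <-] zm]] : (x @` [set m | (p <= m)%N] `&` ball z (d / 2)) !=set0.
    apply: zc; last by apply: nbhsx_ballx; rewrite divr_gt0.
    by apply: filterS (nbhs_infty_ge p) => m pm; exists m.
  exists m => r rP; apply: dB; apply: (ball_split zm).
split=> [|i j]; first by rewrite divr_gt0.
  rewrite (ord1 i) /ball /= !mxE.
  have [r1 r2] : (qq m j)%:R <= ((r j)%:R : R) /\ (r j)%:R <= (qq m j)%:R + 1 :> R.
    by have /andP[? ?] := rP j; rewrite natr1 !ler_nat.
  have := pd m pm; set D := 2 / _ => Dd.
  rewrite (_ : _ - _ = - (D * ((r j)%:R - (qq m j)%:R))); last by rewrite /D; ring.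
  have D0 : 0 <= D by rewrite divr_ge0.
  rewrite normrN ger0_norm ?mulr_ge0 ?subr_ge0//.
  by apply: le_lt_trans Dd; rewrite -[leRHS]mulr1 ler_wpM2l// lerBlDl.
exists z; apply/rowP => i; apply/eqP; rewrite -subr_eq0 -/(h i z).
have [hpos|hneg|//] := ltrgt0P (h i z).
- have [p pB] := near_z _ (hc i z _ (open_nbhs_nbhs (conj (@open_gt _ 0) hpos))).
  have [_ /(_ i)[r [_ [rq _ lr _]]]] := qqP p.
  have rp : (r i <= p.+1)%N.
    by have /andP[_ /leq_trans->//] := rq i; have [/(_ i)] := qqP p.
  by have := lab_le _ _ _ rp lr; rewrite leNgt [_ < _](pB r rq).
- have [p pB] := near_z _ (hc i z _ (open_nbhs_nbhs (conj (@open_lt _ 0) hneg))).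
  have [_ /(_ i)[_ [s [_ sq _ ls]]]] := qqP p.
  by have := lab_ge _ _ _ ls; rewrite leNgt [_ < _](pB s sq).
Qed.

Lemma continuous_sqnorm n : continuous (@sqnorm R n).
Proof.
apply: (@continuous_sum_fin _ _ _ _ (fun i (x : 'rV[R]_n) => x 0 i ^+ 2)) => j x.
rewrite (_ : (fun x : 'rV[R]_n => x 0 j ^+ 2) = (fun x => x 0 j * x 0 j)).
  by apply: (@cvgM _ _ _ (@nbhs_filter 'rV[R]_n x)); exact: coord_continuous.
by apply/funext => y; rewrite expr2.
Qed.

Lemma unit_ball_norm n (x : 'rV[R]_n) i : unit_ball x -> `|x 0 i| <= 1.
Proof.
rewrite /unit_ball /= /sqnorm (bigD1 i)//= => x1.
rewrite -(@ler_pXn2r _ 2)// ?nnegrE// expr1n real_normK ?num_real//.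
by apply: le_trans x1; rewrite lerDl; apply: sumr_ge0 => j _; exact: sqr_ge0.
Qed.

Lemma compact_unit_ball n : compact (@unit_ball R n).
Proof.
apply: subclosed_compact (@compact_cube n) _.
  apply: (@preimage_closed _ _ (@sqnorm R n) [set y | y <= 1]); last exact: closed_le.
  by move=> x _; exact: continuous_sqnorm.
by move=> x xB i /=; have := unit_ball_norm i xB; rewrite in_itv/= ler_norml.
Qed.

(** Composing with the radial retraction onto the ball gives a map to which
    [brouwer_cube] applies, and its fixed point lies in the ball. *)
Lemma brouwer_ball n (t : 'rV[R]_n -> 'rV[R]_n) :
  {within @unit_ball R n, continuous t} ->
  (forall x, unit_ball x -> unit_ball (t x)) ->
  exists2 x, unit_ball x & t x = x.
Proof.
move=> tc tB.
pose m (x : 'rV[R]_n) : R := Num.max 1 (Num.sqrt (sqnorm x)).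
have m1 x : 1 <= m x by rewrite le_max lexx.
have m0 x : 0 < m x := lt_le_trans ltr01 (m1 x).
have sq0 x : 0 <= @sqnorm R n x by apply: sumr_ge0 => i _; exact: sqr_ge0.
pose ret (x : 'rV[R]_n) : 'rV[R]_n := \row_i (x 0 i / m x).
have retB x : unit_ball (ret x).
  rewrite /unit_ball /= /sqnorm; under eq_bigr do rewrite mxE expr_div_n.
  rewrite -mulr_suml ler_pdivrMr ?exprn_gt0// mul1r -/(sqnorm x).
  rewrite -[leLHS]sqr_sqrtr// lerXn2r ?nnegrE ?sqrtr_ge0 ?(ltW (m0 x))//.
  by rewrite le_max lexx orbT.
have ret_id x : unit_ball x -> ret x = x.
  rewrite /unit_ball /= => xB; apply/rowP => i; rewrite mxE /m max_l ?divr1//.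
  by rewrite -sqrtr1 ler_wsqrtr.
have mc : continuous m.
  move=> x; rewrite /m.
  apply: (@continuous_max _ _ (fun=> 1) (fun x => Num.sqrt (sqnorm x))).
    exact: cst_continuous.
  apply: (@continuous_comp _ _ _ (@sqnorm R n) Num.sqrt);
    [exact: continuous_sqnorm | exact: sqrt_continuous].
have retc : continuous ret.
  apply: continuous_row => i; under eq_fun do rewrite mxE.
  move=> x; apply: (@cvgM _ _ _ (@nbhs_filter 'rV[R]_n x)).
    exact: coord_continuous.
  by apply: (@cvgV _ _ _ (@nbhs_filter 'rV[R]_n x)); [rewrite gt_eqF|exact: mc].
have gc : continuous (t \o ret).
  move=> x B tB'.
  move/subspace_continuousP : tc => /(_ _ (retB x)) tcx.
  have rB : nbhs (ret x) [set u | unit_ball u -> B (t u)] := tcx B tB'.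
  have rx : nbhs x [set y | unit_ball (ret y) -> B (t (ret y))] := retc x _ rB.
  suff : nbhs x [set y | B (t (ret y))] by [].
  apply: (@filterS _ _ (@nbhs_filter 'rV[R]_n x)) rx => y; exact.
have [|x xE] := @brouwer_cube n (t \o ret) gc.
  by move=> x i; exact: unit_ball_norm (tB _ (retB x)).
have xB : unit_ball x by rewrite -xE; exact: tB.
by exists x => //; rewrite -{2}xE /= ret_id.
Qed.
End Brouwer.

(** * Cells of a finite CW complex *)

(* The dimension of a cell, as opposed to that of a vector space. *)
Local Notation dim := Defs.dim.

Section Cells.
Context {R : realType} {X : topologicalType} (K : finite_cw R X).
Implicit Types c d e v : cell K.

Lemma closed_cell_closed c : closed (closed_cell c).
Proof.
apply: compact_closed (cw_hausdorff K) _.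
apply: continuous_compact; last exact: compact_unit_ball.
exact: charmap_continuous.
Qed.

Lemma open_cellW c : open_cell c `<=` closed_cell c.
Proof. by move=> _ [y yB <-]; exists y => //; exact: ltW yB. Qed.

(** A closed cell is the closure of its open cell: a boundary point is the limit
    of the images of the points (1 - s) y. *)
Lemma closed_cell_min c (Z : set X) :
  closed Z -> open_cell c `<=` Z -> closed_cell c `<=` Z.
Proof.
move=> cZ oZ _ [y yB <-]; apply: contrapT => nZ.
have nb : nbhs (charmap c y) (~` Z).
  by apply: open_nbhs_nbhs; split => //; exact: closed_openC.
have /subspace_continuousP/(_ y yB) cc := @charmap_continuous _ _ K c.
have : nbhs y [set u | unit_ball u -> ~ Z (charmap c u)] := cc _ nb.
move=> /nbhs_ballP[r /= r0 rZ].
pose s := Num.min r 1 / 2.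
have m0 : 0 < Num.min r 1 by rewrite lt_min r0 ltr01.
have [mr m1] : Num.min r 1 <= r /\ Num.min r 1 <= 1.
  by rewrite !ge_min !lexx orbT.
have uB : sqnorm ((1 - s) *: y) < 1.
  rewrite /sqnorm; under eq_bigr do rewrite mxE exprMn.
  rewrite -mulr_sumr -/(sqnorm y).
  have /le_lt_trans : (1 - s) ^+ 2 * sqnorm y <= (1 - s) ^+ 2 * 1.
    by rewrite ler_wpM2l ?sqr_ge0.
  apply; rewrite mulr1 expr_lt1// /s; lra.
apply: (rZ ((1 - s) *: y)) (ltW uB) _; last by apply: oZ; exists ((1 - s) *: y).
split=> // i j; rewrite (ord1 i) /ball /= !mxE.
rewrite (_ : _ - _ = s * y 0 j); last by ring.
rewrite normrM gtr0_norm ?divr_gt0//.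
have : s * `|y 0 j| <= s * 1.
  by rewrite ler_wpM2l ?divr_ge0 ?(ltW m0)//; exact: unit_ball_norm.
rewrite /s; lra.
Qed.

Lemma open_cell_inj c d x : open_cell c x -> open_cell d x -> c = d.
Proof.
by have [e [_ eu]] := cw_partition K x => /eu <- /eu.
Qed.

Lemma mem_open_cell x : exists c, open_cell c x.
Proof. by have [c [cx _]] := cw_partition K x; exists c. Qed.

Lemma sqnorm0 n : sqnorm (0 : 'rV[R]_n) = 0.
Proof. by rewrite /sqnorm big1// => i _; rewrite mxE expr0n. Qed.

Lemma sqnormZ_delta n (a : R) (i : 'I_n) : sqnorm (a *: delta_mx 0 i : 'rV_n) = a ^+ 2.
Proof.
rewrite /sqnorm (bigD1 i)//= !mxE !eqxx mulr1 big1 ?addr0// => j ji.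
by rewrite !mxE eqxx (negPf ji) mulr0 expr0n.
Qed.

Lemma open_cell_center c : open_cell c (charmap c 0).
Proof. by exists 0 => //; rewrite /open_unit_ball /= sqnorm0. Qed.

Lemma closed_cell_dim c d x :
  closed_cell c x -> open_cell d x -> d = c \/ (dim d < dim c)%N.
Proof.
move=> [y yB <-] dx; move: yB; rewrite /unit_ball /= le_eqVlt => /orP[/eqP yS|yB].
  right; have [e /= ec ex] := @charmap_boundary _ _ K c _ (ex_intro2 _ _ y yS erefl).
  by rewrite (open_cell_inj dx ex).
by left; apply: open_cell_inj dx _; exists y.
Qed.

Lemma vertex_cell v x : dim v = 0%N -> closed_cell v x -> x = charmap v 0.
Proof.
move=> v0 [y _ <-]; congr charmap; apply/rowP => i; exfalso.
by have := ltn_ord i; rewrite [X in (_ < X)%N]v0.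
Qed.

(** This makes being a vertex a property of the open cell as a subset, hence
    invariant under homeomorphisms permuting the cells. *)
Lemma dim_eq0 d :
  (forall x y, open_cell d x -> open_cell d y -> x = y) -> dim d = 0%N.
Proof.
move=> dx; apply/eqP; rewrite eqn0Ngt; apply/negP => d0.
pose i := Ordinal d0; pose z : 'rV[R]_(dim d) := 2^-1 *: delta_mx 0 i.
have zB : @open_unit_ball R (dim d) z.
  by rewrite /open_unit_ball /= sqnormZ_delta; lra.
have oB : @open_unit_ball R (dim d) 0 by rewrite /open_unit_ball /= sqnorm0.
have [_ inj _] := charmap_interior d.
have zE : charmap d z = charmap d 0 by apply: dx; [exists z | exists 0].
have z0 : z = 0 by apply: inj zE; exact: mem_set.
have := congr1 (fun x : 'rV_(dim d) => x 0 i) z0; rewrite !mxE !eqxx mulr1 => /eqP.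
by rewrite invr_eq0 pnatr_eq0.
Qed.

End Cells.

(** * Strongly regular complexes *)
Section StronglyRegular.
Context {R : realType} {X : topologicalType} (K : finite_cw R X).
Context (sr : strongly_regular K).
Implicit Types c d e v : cell K.

(** The intersection of the two closed cells is a closed cell e. A point of the
    open cell d lies in it, so d is e or has smaller dimension; the centre of e
    lies in the closed cell d, so e is d or has smaller dimension. *)
Lemma closed_cell_meets c d x :
  closed_cell c x -> open_cell d x -> closed_cell d `<=` closed_cell c.
Proof.
move=> cx dx; have dx' := open_cellW dx.
have [_ /(_ c d)[E|[e E]]] := sr; first by have : set0 x by rewrite -E.
have ex : closed_cell e x by rewrite -E.
have [_ de] : (closed_cell c `&` closed_cell d) (charmap e 0).
  by rewrite E; apply: open_cellW; exact: open_cell_center.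
have ee := open_cell_center e.
have ed : d = e.
  have [//|lt_de] := closed_cell_dim ex dx.
  by have [->//|] := closed_cell_dim de ee; rewrite ltnNge ltnW.
by rewrite ed -E; exact: subIsetl.
Qed.

(** Descend through the boundary of the cell. *)
Lemma exists_vertex c :
  exists2 v : cell K, dim v = 0%N & closed_cell v `<=` closed_cell c.
Proof.
have [n] := ubnP (dim c); elim: n c => // n IH c cn.
have [c0|c0] := posnP (dim c); first by exists c.
pose i := Ordinal c0; pose y : 'rV[R]_(dim c) := 1 *: delta_mx 0 i.
have yS : @unit_sphere R (dim c) y.
  by rewrite /unit_sphere /= sqnormZ_delta expr1n.
have [d /= dc dx] := @charmap_boundary _ _ K c _ (ex_intro2 _ _ y yS erefl).
have [|v v0 vd] := IH d; first exact: leq_trans dc _.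
exists v => //; apply: subset_trans vd _.
by apply: closed_cell_meets dx; exists y => //; rewrite /unit_ball /= yS.
Qed.

Lemma exists_facet c :
  exists2 p : cell K, p \in cw_facets K & closed_cell c `<=` closed_cell p.
Proof.
pose below d := [set e : cell K | `[< closed_cell e `<=` closed_cell d >]]%SET.
pose P d := `[< closed_cell c `<=` closed_cell d >].
have Pc : P c by apply/asboolP.
case: (@arg_maxnP _ c P (fun d => #|below d|) Pc) => p /asboolP cp pmax.
exists p => //; rewrite inE; apply/asboolP => d pd.
apply/seteqP; split=> //.
have bpd : below p \subset below d.
  apply/fintype.subsetP => e; rewrite !inE => ep; exact: subset_trans ep pd.
have /pmax le_dp : P d by apply/asboolP; exact: subset_trans cp pd.
have : d \in below d by rewrite inE; apply/asboolP.
have /eqP <- : below p == below d by rewrite eqEcard bpd.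
by rewrite inE => /asboolP.
Qed.

(** Transported through the embedding of the closed ball, such a map would
    contradict [brouwer_ball]. *)
Lemma no_invariant_cell (tau : X -> X) e : continuous tau ->
  (forall x, tau x <> x) -> ~ (closed_cell e `<=` tau @^-1` closed_cell e).
Proof.
move=> tauc tau_free inv.
have [/(_ e)[fc finj femb] _] := sr.
have /choice[t tP] : forall y, exists z, unit_ball y ->
    unit_ball z /\ charmap e z = tau (charmap e y).
  move=> y; have [yB|nB] := pselect (unit_ball y); last by exists 0.
  have [z zB <-] : closed_cell e (tau (charmap e y)) by apply: inv; exists y.
  by exists z.
have [||x xB tx] := @brouwer_ball R _ t.
- apply/subspace_continuousP => y yB B tB.
  have [U [Uo Uy] UB] : exists2 U, open_nbhs (t y) U & U `<=` B.
    by move: tB; rewrite nbhsE => -[U ? ?]; exists U.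
  have [V Vo UV] := femb U Uo.
  have [tyB ty] := tP y yB.
  have Vy : V (tau (charmap e y)).
    have : (charmap e @` (@unit_ball R (dim e) `&` U)) (charmap e (t y)).
      by exists (t y).
    by rewrite UV ty => -[].
  have nV : nbhs (charmap e y) (tau @^-1` V).
    by apply: tauc; exact: open_nbhs_nbhs.
  have /subspace_continuousP/(_ y yB) fy := fc.
  have yV : nbhs y [set u | unit_ball u -> V (tau (charmap e u))] := fy _ nV.
  suff : nbhs y [set u | unit_ball u -> B (t u)] by [].
  apply: (@filterS _ _ (@nbhs_filter 'rV[R]_(dim e) y)) yV => u uV uB.
  have [tuB tu] := tP u uB; apply: UB.
  have : (charmap e @` @unit_ball R (dim e) `&` V) (charmap e (t u)).
    by split; [exists (t u) | rewrite tu; exact: uV].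
  rewrite -UV => -[z [zB Uz] ztu].
  by rewrite (finj (t u) z)//; exact: mem_set.
- by move=> y /tP[].
- by have [_] := tP x xB; rewrite tx => /esym; exact: tau_free.
Qed.

End StronglyRegular.

(** * Involutions permuting the cells *)
Section CellInvolution.
Context {R : realType} {X : topologicalType} (K : finite_cw R X).
Context (tau : X -> X) (tauc : continuous tau) (tauK : involutive tau).
Context (s : cell K -> cell K).
Context (tau_open : forall c, tau @` open_cell c = open_cell (s c)).
Implicit Types c d e v : cell K.

Lemma cell_involutive : involutive s.
Proof.
move=> c; apply: open_cell_inj (open_cell_center c).
rewrite -tau_open -tau_open; exists (tau (charmap c 0)); last exact: tauK.
by exists (charmap c 0) => //; exact: open_cell_center.
Qed.

Lemma closed_cell_tau c x : closed_cell c x -> closed_cell (s c) (tau x).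
Proof.
apply: (@closed_cell_min _ _ _ c (tau @^-1` closed_cell (s c))).
  by apply: preimage_closed; [move=> y _; exact: tauc | exact: closed_cell_closed].
by move=> y yc; apply: open_cellW; rewrite -tau_open; exists y.
Qed.

Lemma closed_cell_tauE c x : closed_cell (s c) (tau x) <-> closed_cell c x.
Proof.
split; last exact: closed_cell_tau.
by move/closed_cell_tau; rewrite cell_involutive tauK.
Qed.

Lemma cell_involution_vertex v : dim v = 0%N -> dim (s v) = 0%N.
Proof.
move=> v0; apply: dim_eq0 => x y; rewrite -tau_open => -[a av <-] [b bv <-].
by rewrite (vertex_cell v0 (open_cellW av)) (vertex_cell v0 (open_cellW bv)).
Qed.

Lemma tau_vertex v : dim v = 0%N -> tau (charmap v 0) = charmap (s v) 0.
Proof.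
move=> v0; apply: vertex_cell; first exact: cell_involution_vertex.
by apply: closed_cell_tau; apply: open_cellW; exact: open_cell_center.
Qed.

Lemma cell_involution_sub c d :
  closed_cell (s c) `<=` closed_cell d -> closed_cell c `<=` closed_cell (s d).
Proof.
move=> cd x /closed_cell_tau /cd /closed_cell_tau.
by rewrite tauK.
Qed.

Lemma cell_involution_facet c : c \in cw_facets K -> s c \in cw_facets K.
Proof.
rewrite !(inE, asboolE) => cf d sd; have sdc := cf _ (cell_involution_sub sd).
apply/seteqP; split=> // x /closed_cell_tau; rewrite sdc => /closed_cell_tau.
by rewrite tauK.
Qed.

(** The intersection of the cell with its image is invariant and contains
    [charmap v 0], so that it would be an invariant closed cell. *)
Lemma no_antipodal_vertices c v : strongly_regular K ->
  (forall x, tau x <> x) -> dim v = 0%N ->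
  closed_cell c (charmap v 0) -> closed_cell c (charmap (s v) 0) -> False.
Proof.
move=> sr free v0 cv csv.
have scv : closed_cell (s c) (charmap v 0).
  by rewrite -[charmap v 0]tauK tau_vertex//; exact: closed_cell_tau.
have [_ /(_ c (s c))[E|[e E]]] := sr.
  by have : set0 (charmap v 0) by rewrite -E.
apply: (no_invariant_cell sr tauc free (e := e)).
rewrite -E => x [cx sx]; split; last exact: closed_cell_tau.
by rewrite -(cell_involutive c); exact: closed_cell_tau.
Qed.

End CellInvolution.

(** * Partitions of unity and the bound *)

(** Induction on the list. A function of Urysohn, supported in the first open
    set, is 1 on the part of [C] missed by the others. Its zero set in [C] is
    then covered by the others, to which the induction hypothesis applies. *)
Lemma urysohn_cover (R : realType) (T : topologicalType) (V : finType)
    (O : V -> set T) (l : seq V) (C : set T) :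
  normal_space T -> (forall u, open (O u)) -> closed C ->
  (forall x, C x -> exists2 u, u \in l & O u x) ->
  exists g : V -> T -> R, [/\ forall u, continuous (g u),
    forall u x, 0 <= g u x, forall u x, g u x != 0 -> O u x &
    forall x, C x -> 0 < \sum_u g u x].
Proof.
move=> nT Oo; elim: l C => [|a l IH] C cC covC.
  exists (fun _ _ => 0); split=> [u|//|u x|x /covC[]//]; first exact: cst_continuous.
  by rewrite eqxx.
pose C1 := C `&` ~` (\bigcup_(u in [set u | u \in l]) O u).
have cC1 : closed C1.
  apply: closedI => //; apply: open_closedC; exact: bigcup_open.
have C1O : ~` O a `&` C1 = set0.
  apply/seteqP; split=> // x [nx [/covC[u]]].
  by rewrite inE => /predU1P[->//|ul] ux; case; exists u.
have /(@uniform_separatorP _ R)[h [hc h01 h0 h1]] :=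
  (@normal_separatorP R T).1 nT _ _ (open_closedC (Oo a)) cC1 C1O.
have h_ge0 x : 0 <= h x.
  have : `[0, 1]%classic (h x) by apply: h01; exists x.
  by rewrite /= in_itv/= => /andP[].
have hO x : h x != 0 -> O a x.
  by move=> hx; apply: contrapT => nx; case/eqP: hx; apply: h0; exists x.
have [||g [gc g0 gO gp]] := IH (C `&` h @^-1` [set y | y <= 0]).
- apply: closedI => //; apply: preimage_closed; last exact: closed_le.
  by move=> x _; exact: hc.
- move=> x [Cx /= hx]; apply: contrapT => nx.
  have : h x = 1.
    apply: h1; exists x => //; split=> // -[u ul ux]; apply: nx; exists u => //.
  by move=> h1x; move: hx; rewrite h1x ler10.
exists (fun u x => g u x + (if u == a then h x else 0)); split.
- move=> u; case: eqP => _ x; apply: cvgD; try exact: gc; first exact: hc.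
  exact: cst_continuous.
- by move=> u x; apply: addr_ge0 => //; case: eqP.
- move=> u x; case: (u =P a) => [->|_]; last by rewrite addr0; exact: gO.
  have [->|/gO//] := eqVneq (g a x) 0; rewrite add0r; exact: hO.
move=> x Cx; rewrite big_split/= -big_mkcond/= big_pred1_eq.
have sum0 : 0 <= \sum_u g u x by exact: sumr_ge0.
have [hx|hx] := leP (h x) 0; last exact: ltr_wpDl.
by apply: ltr_wpDr => //; exact: gp.
Qed.

Lemma compact_cw (R : realType) (X : topologicalType) (K : finite_cw R X) :
  compact [set: X].
Proof.
have -> : [set: X] = \big[setU/set0]_(c : cell K) closed_cell c.
  apply/seteqP; split=> // x _; have [c cx] := mem_open_cell K x.
  by rewrite (bigD1 c)//=; left; exact: open_cellW.
apply: bigsetU_compact => c _; apply: continuous_compact; last exact: compact_unit_ball.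
exact: charmap_continuous.
Qed.

(** The complement is the union of the closed cells avoiding the vertex. *)
Lemma vertex_star_open (R : realType) (X : topologicalType) (K : finite_cw R X) v :
  open [set x | forall c : cell K, closed_cell c x -> closed_cell c v].
Proof.
rewrite (_ : [set _ | _] = ~` \big[setU/set0]_(c : cell K | `[< ~ closed_cell c v >]) closed_cell c).
  apply: closed_openC; elim/big_ind : _ => [|A B|c _]; first exact: closed0.
    exact: closedU.
  exact: closed_cell_closed.
apply/seteqP; split=> x.
  move=> H; rewrite -bigcup_seq_cond => -[c /= /andP[_ /asboolP cv] /H].
  exact: cv.
move=> H c cx; apply: contrapT => cv; apply: H.
by rewrite (bigD1 c)/=; [left | apply/asboolP].
Qed.

(** The star of a vertex consists of the points all of whose closed cells contain
    it. The stars cover the space, as a point in the open cell d lies in the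
    star of any vertex of d by [closed_cell_meets], and the vertices whose star
    contains the point all lie in any facet through d. *)
Lemma cw_ind_le (R : realType) (X : topologicalType) (K : finite_cw R X)
    (tau : X -> X) :
  [set: X] !=set0 -> strongly_regular K -> free_involution tau ->
  permutes_cells K tau ->
  (ind R tau <=
    (24 * expR 1 ^+ 2 * ln (#|cw_vertices K|%:R) * ln (#|cw_facets K|%:R))%:E)%E.
Proof.
move=> X0 sr [tauc tauK free] /choice[s ss].
have sK := cell_involutive tauK ss.
pose V := {v : cell K | v \in cw_vertices K}.
pose F := {p : cell K | p \in cw_facets K}.
have V0 (u : V) : dim (val u) = 0%N by have := valP u; rewrite inE => /eqP.
have sV_sub (u : V) : s (val u) \in cw_vertices K.
  by rewrite inE (cell_involution_vertex ss (V0 u)).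
pose sV (u : V) : V := exist _ (s (val u)) (sV_sub u).
have sF_sub (p : F) : s (val p) \in cw_facets K.
  exact: (cell_involution_facet tauc tauK ss (valP p)).
pose sF (p : F) : F := exist _ (s (val p)) (sF_sub p).
pose pt (u : V) : X := charmap (val u) 0.
pose O (u : V) := [set x | forall c : cell K, closed_cell c x -> closed_cell c (pt u)].
have nX : normal_space X by exact: compact_normal (cw_hausdorff K) (compact_cw K).
have ptsV u : tau (pt u) = pt (sV u) by exact: (tau_vertex tauc ss (V0 u)).
have covO x : [set: X] x -> exists2 u, u \in enum {: V} & O u x.
  move=> _; have [d dx] := mem_open_cell K x.
  have [v v0 vd] := exists_vertex sr d.
  have vV : v \in cw_vertices K by rewrite inE v0.
  exists (exist _ v vV : V); first by rewrite mem_enum.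
  move=> c cx; apply: (closed_cell_meets sr cx dx); apply: vd.
  by apply: open_cellW; exact: open_cell_center.
have [g [gc g0 gO gp]] := @urysohn_cover R X V O _ [set: X] nX
  (fun u => vertex_star_open K (pt u)) closedT covO.
(* Symmetrising the functions makes the coordinates equivariant. *)
pose h u x := g u x + g (sV u) (tau x).
have sVK : involutive sV by move=> u; apply: val_inj; exact: sK.
have hsum x : 0 < \sum_u h u x.
  rewrite big_split/=; apply: ltr_pwDl; first exact: gp.
  by apply: sumr_ge0 => u _.
pose y x u := h u x / \sum_w h w x.
rewrite -(card_sig (mem (cw_vertices K))) -(card_sig (mem (cw_facets K))).
have htau u x : h u (tau x) = h (sV u) x by rewrite /h tauK sVK addrC.
have hc u : continuous (h u).
  move=> x; apply: cvgD; first exact: gc.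
  apply: (@continuous_comp _ _ _ tau (g (sV u))); [exact: tauc|exact: gc].
have hO u x : h u x != 0 -> O u x.
  have [g0x|/gO//] := eqVneq (g u x) 0; rewrite /h g0x add0r => /gO sx c cx.
  apply/(closed_cell_tauE tauc tauK ss); rewrite ptsV.
  by apply: sx; exact: closed_cell_tau.
apply: (@ind_le_log R X tau V F sV sF
  (fun u p => `[< closed_cell (val p) (pt u) >]) y) => //.
- by move=> p; apply: val_inj; exact: sK.
- move=> u p; apply/asbool_equiv_eq; rewrite -ptsV.
  exact: closed_cell_tauE.
- move=> u p; apply/negP => /andP[/asboolP pu /asboolP psu].
  exact: (no_antipodal_vertices tauc tauK ss sr free (V0 u) pu psu).
- move=> u x; apply: cvgM; first exact: hc.
  apply: cvgV; first by rewrite gt_eqF.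
  exact: (@continuous_sum_fin _ _ _ _ h).
- move=> x; apply/funext => u; rewrite /y /= htau; congr (_ / _).
  rewrite [RHS](reindex_inj (inv_inj sVK)).
  by apply: eq_bigr => w _; exact: htau.
- move=> x; split; first split.
  + by move=> u; rewrite divr_ge0 ?(ltW (hsum x))// addr_ge0.
  + by rewrite -mulr_suml divff// gt_eqF.
  have [d dx] := mem_open_cell K x; have [p pf dp] := exists_facet d.
  exists (exist _ p pf) => u; rewrite mulf_eq0 negb_or => /andP[/hO ux _].
  by apply/asboolP; apply: ux; apply: dp; exact: open_cellW.
Qed.

Theorem theorem1 (R : realType) :
  (forall (X : topologicalType) (K : finite_cw R X) (tau : X -> X),
     [set: X] !=set0 ->
     strongly_regular K ->
     free_involution tau ->
     permutes_cells K tau ->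
     (ind R tau <=
        (24 * expR 1 ^+ 2 * ln (#|cw_vertices K|%:R) * ln (#|cw_facets K|%:R))%:E)%E)
  /\
  (forall (V : finType) (K : simplicial_complex V) (sigma : V -> V)
          (sigmaK : simplicial_map K K sigma),
     (0 < #|V|)%N ->
     involutive sigma ->
     (forall a : realization R K, realization_map sigmaK a <> a) ->
     (ind R (realization_map (R := R) sigmaK) <=
        (24 * expR 1 ^+ 2 * ln (#|V|%:R) * ln (#|facets K|%:R))%:E)%E).
Proof.
split=> [X K tau|V K sigma sigmaK V0 sK free]; first exact: cw_ind_le.
exact: simplicial_ind_le.
Qed.
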